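(* Suppose that $(L_\epsilon)_{\epsilon \in E}$ is a family of bounded linear operators on $(X,\|\cdot\|)$ satisfying conditions (KL1), (KL2) and (KL3) given in the context, and suppose that $\lambda\in\mathbb C$ with $|\lambda|>a$ is a pole of the resolvent of $L_0$ of order $p$. Fix $r$ with $a<r<|\lambda|$. Then there is a constant $\delta_2=\delta_2(r)>0$ such that for every $\delta\in (0,\delta_2]$ there are constants $K_2=K_2(r,\delta,p)>0$ and $\epsilon_2=\epsilon_2(r,\delta)>0$ with the following properties: $$\Delta_\delta(\lambda)\cap \sigma_r(L_\epsilon)\neq\emptyset \quad \text{for all } \epsilon\in [0,\epsilon_2]\,,$$ $$\sup\{\, |\lambda'-\lambda| \,:\, \lambda'\in \Delta_\delta(\lambda)\cap \sigma_r(L_\epsilon)\,\} \leq K_2\, \tau_\epsilon^{\eta/p} \quad \text{for all } \epsilon \in [0,\epsilon_2]\,,$$ where $$\eta=\frac{\log(r/a)}{\log(A/a)}\,.$$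
   Context: $(X,\|\cdot\|)$ is a (complex) Banach space equipped with a second norm $|\cdot|_w$ such that $|f|_w\le\|f\|$ for all $f\in X$. For a bounded linear operator $L:X\to X$ put $|||L|||=\sup\{|Lf|_w : f\in X,\ \|f\|\le1\}$. $\sigma(L)$ denotes the spectrum of $L$ on $(X,\|\cdot\|)$, $\sigma_r(L)=\{z\in\mathbb C:|z|\le r\}\cup\sigma(L)$, and $\Delta_\delta(\lambda)=\{z\in\mathbb C:|z-\lambda|\le\delta\}$. $E=[0,\epsilon']$ with $\epsilon'>0$ a constant, and $(L_\epsilon)_{\epsilon\in E}$ is a family of bounded linear operators on $(X,\|\cdot\|)$. The conditions are: (KL1) There are constants $C_1,C_2,C_3>0$ and $0<a<A$ such that for every $\epsilon\in E$, $|L_\epsilon^nf|_w\le C_1A^n|f|_w$ and $\|L_\epsilon^nf\|\le C_2a^n\|f\|+C_3A^n|f|_w$ for all $f\in X$ and $n\in\mathbb N$. (KL2) For every $\epsilon\in E$, if $z\in\sigma(L_\epsilon)$ and $|z|>a$ then $z$ does not belong to the residual spectrum of $L_\epsilon$. (KL3) There is a monotonic upper-semicontinuous function $\tau:E\to[0,\infty)$, $\epsilon\mapsto\tau_\epsilon$, with $\lim_{\epsilon\downarrow0}\tau_\epsilon=0$ and $|||L_\epsilon-L_0|||\le\tau_\epsilon$ for all $\epsilon\in E$. The numbers $a$, $A$ and the function $\tau$ in the claim are those of (KL1) and (KL3). *)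

(* Defs.v *)
From HB Require Import structures.
From mathcomp Require Import all_boot all_order all_algebra.
From mathcomp Require Import complex.
From mathcomp Require Import all_classical all_reals all_analysis.
Set Implicit Arguments.
Unset Strict Implicit.
Unset Printing Implicit Defensive.
Import Order.TTheory GRing.Theory Num.Theory.
Import numFieldNormedType.Exports.
Local Open Scope classical_set_scope.
Local Open Scope ring_scope.
Local Open Scope complex_scope.

(* A complex Banach space is a completeNormedModType over R[i], R : realType.
   Its norm takes values in R[i], so that a nonnegative real number is found
   as a complex number with zero imaginary part; rnorm reads it back in R.
   As R[i] is normed over itself, rnorm also gives the modulus on R[i]. *)
Definition rnorm (R : realType) (V : normedZmodType R[i]) (x : V) : R :=
  complex.Re `|x|.

Section Operators.
Variables (R : realType) (X : completeNormedModType R[i]).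
Implicit Types (w : X -> R) (L S : {linear X -> X}) (T : X -> X) (z : R[i]).

Definition is_norm w : Prop :=
  [/\ forall f, 0 <= w f,
      forall f, w f = 0 -> f = 0,
      forall f g, w (f + g) <= w f + w g
    & forall z f, w (z *: f) = rnorm z * w f].

Definition bounded_op T : Prop :=
  exists M : R, forall f, rnorm (T f) <= M * rnorm f.

(* For w := rnorm this is the operator norm; for a weaker norm w it is
   the mixed norm |||T|||.  The supremum is taken in R, which is meaningful
   because T is bounded and w <= rnorm in all uses. *)
Definition onorm w T : R := sup [set w (T f) | f in [set f | rnorm f <= 1]].

(* S is the bounded inverse of z - L *)
Definition is_resolvent L z S : Prop :=
  [/\ bounded_op S,
      forall f, S (z *: f - L f) = f
    & forall f, z *: S f - L (S f) = f].

Definition spectrum L : set R[i] :=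
  [set z | ~ exists S, is_resolvent L z S].

Definition residual_spectrum L : set R[i] :=
  [set z | [/\ spectrum L z,
               injective (fun f : X => z *: f - L f)
             & ~ dense (range (fun f : X => z *: f - L f))]].

Definition sigma_r (r : R) L : set R[i] :=
  [set z | rnorm z <= r] `|` spectrum L.

(* lam is an isolated point of the spectrum, near which the resolvent has the
   Laurent expansion  sum_(n >= 0) (z - lam)^(n - p) B_n  with B_0 <> 0,
   converging in operator norm. *)
Definition resolvent_pole L (lam : R[i]) (p : nat) : Prop :=
  [/\ (0 < p)%N, spectrum L lam
    & exists rho : R, exists B : nat -> {linear X -> X},
      [/\ 0 < rho,
          forall n, bounded_op (B n),
          exists f, B 0%N f != 0
        & forall z, 0 < rnorm (z - lam) < rho ->
            exists S : {linear X -> X}, is_resolvent L z S /\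
              onorm (@rnorm R X) (fun f => S f -
                 \sum_(n < N) ((z - lam) ^+ n / (z - lam) ^+ p) *: B n f)
                @[N --> \oo] --> (0 : R)]].

End Operators.

Definition disk (R : realType) (delta : R) (lam : R[i]) : set R[i] :=
  [set z | rnorm (z - lam) <= delta].

(* "Monotonic" allows both directions of monotonicity. *)
Definition monotonic_on (R : realType) (E : interval R) (tau : R -> R) : Prop :=
  {in E &, {homo tau : x y / x <= y}} \/ {in E &, {homo tau : x y /~ x <= y}}.

Definition usc_on (R : realType) (E : set R) (tau : R -> R) : Prop :=
  forall x, E x -> forall c, tau x < c -> \forall y \near within E (nbhs x), tau y < c.

(* A family indexed by E = [0, e'] is a function on R of which only the values
   at the points of E matter. *)
Section KellerLiverani.
Variables (R : realType) (X : completeNormedModType R[i]) (w : X -> R).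
Variables (e' : R) (L : R -> {linear X -> X}).

Definition KL1 (C1 C2 C3 a A : R) : Prop :=
  [/\ [/\ 0 < C1, 0 < C2 & 0 < C3], 0 < a < A &
      forall e : R, 0 <= e <= e' -> forall (f : X) (n : nat),
        w (iter n (L e) f) <= C1 * A ^+ n * w f /\
        rnorm (iter n (L e) f) <= C2 * a ^+ n * rnorm f + C3 * A ^+ n * w f].

Definition KL2 (a : R) : Prop :=
  forall e : R, 0 <= e <= e' -> forall z : R[i],
    spectrum (L e) z -> a < rnorm z -> ~ residual_spectrum (L e) z.

Definition KL3 (tau : R -> R) : Prop :=
  [/\ forall e : R, 0 <= e <= e' -> 0 <= tau e,
      monotonic_on `[0, e'] tau,
      usc_on `[0, e'] tau,
      tau e @[e --> 0^'+] --> (0 : R)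
    & forall e : R, 0 <= e <= e' ->
        onorm w (fun f => L e f - L 0 f) <= tau e].

End KellerLiverani.

(* Main.v *)
Require Import Defs.
From HB Require Import structures.
From mathcomp Require Import all_boot all_order all_algebra.
From mathcomp Require Import complex.
From mathcomp Require Import all_classical all_reals all_analysis.
From mathcomp Require Import ring lra.
Import Order.TTheory GRing.Theory Num.Theory.
Import numFieldNormedType.Exports.
Local Open Scope classical_set_scope.
Local Open Scope ring_scope.
Local Open Scope complex_scope.
Set Implicit Arguments.
Unset Strict Implicit.

(** Write [Q_e = z - L_e] and [R_e = Q_e^-1], and let [H] bound the operator
    norm of [R_0] at [z], where [r <= |z|].

    Localization.  The geometric resolvent expansion, cut after [n] terms, and
    the Lasota-Yorke inequality bound the strong norm of [f] by a small multiple
    of itself, plus a multiple of [w f], plus a multiple of [Q_e f]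
    ([orbit_bound]).  The weak norm is controlled through
    [f = R_0 Q_e f + R_0 (L_e - L_0) f]: the operator [L_e - L_0] is only small
    from the strong to the weak norm, so [R_0] has to be estimated on vectors of
    small weak norm, and a second cut-off [m] is optimized there
    ([resolvent_weak_bound]).  The two competing errors are [(a/r)^m] and
    [(A/r)^m t], with [t] the size of the perturbation; balancing them at
    [(A/a)^m ~ 1/t] makes both of order [t^eta], and this is where the exponent
    [eta] comes from ([geometric_balance]).  Hence [Q_e] is bounded below as soon
    as [H t^eta] is small ([perturbed_lower_bound]); its range being dense
    unless [z] is in the residual spectrum, [Q_e] is then invertible
    ([nonresidual_lower_bound]).  Near a pole of order [p] one may take
    [H ~ |z - lam|^-p] ([pole_estimates]), so that a point of the spectrum of
    [L_e] satisfies [|z - lam|^p <= K t^eta] ([spectrum_localized]).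

    Persistence.  The leading Laurent coefficient at the pole takes its values in
    the eigenspace of [L_0] at [lam]; let [g] be an eigenvector.  If a disk around
    [lam] were free of spectrum of [L_e], the map
    [F(u) = u (lam + u - L_e)^-1 g] would be analytic on it with [F(0) = 0].  On a
    circle around [lam], on the other hand, [F(u)] is close in the weak norm to
    [u (lam + u - L_0)^-1 g = g].  This contradicts the mean value property
    ([spectrum_persists]).

    No contour integrals are used: the mean value property is obtained for means
    over the vertices of regular polygons ([mean_value]), from a quadratic Taylor
    remainder that is uniform on the disk.  For [F] this remainder follows from
    the resolvent identity and a uniform resolvent bound, which comes from
    compactness ([resolvent_bound_on_disk]). *)

(** * The real-valued norm *)

Section RealNorm.
Variable R : realType.
Implicit Types (V : normedZmodType R[i]) (X : normedModType R[i]) (z u : R[i]).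

Lemma normE V (x : V) : `|x| = (rnorm x)%:C.
Proof. by rewrite /rnorm RRe_real // normr_real. Qed.

Lemma rnorm_ge0 V (x : V) : 0 <= rnorm x.
Proof. by rewrite -lecR -normE normr_ge0. Qed.

Lemma rnorm0 V : rnorm (0 : V) = 0.
Proof. by rewrite /rnorm normr0. Qed.

Lemma rnorm_eq0 V (x : V) : rnorm x = 0 -> x = 0.
Proof. by move=> x0; apply: normr0_eq0; rewrite normE x0. Qed.

Lemma rnorm_gt0 V (x : V) : x != 0 -> 0 < rnorm x.
Proof.
move=> x0; rewrite lt_neqAle rnorm_ge0 andbT eq_sym.
by apply: contra_neq x0; exact: rnorm_eq0.
Qed.

Lemma ler_rnormD V (x y : V) : rnorm (x + y) <= rnorm x + rnorm y.
Proof. by rewrite -lecR rmorphD /= -!normE ler_normD. Qed.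

Lemma rnormN V (x : V) : rnorm (- x) = rnorm x.
Proof. by rewrite /rnorm normrN. Qed.

Lemma ler_rnormB V (x y : V) : rnorm (x - y) <= rnorm x + rnorm y.
Proof. by rewrite -(rnormN y) ler_rnormD. Qed.

Lemma rnormBC V (x y : V) : rnorm (x - y) = rnorm (y - x).
Proof. by rewrite -rnormN opprB. Qed.

Lemma rnormZ X z (x : X) : rnorm (z *: x) = rnorm z * rnorm x.
Proof. by apply: complexI; rewrite -normE normrZ !normE rmorphM. Qed.

Lemma rnormM z u : rnorm (z * u) = rnorm z * rnorm u.
Proof. by apply: complexI; rewrite -normE normrM !normE rmorphM. Qed.

Lemma rnormX z n : rnorm (z ^+ n) = rnorm z ^+ n.
Proof. by elim: n => [|n IH]; rewrite ?expr0 ?exprS ?rnormM ?IH // /rnorm normr1. Qed.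

Lemma rnormV z : rnorm z^-1 = (rnorm z)^-1.
Proof. by apply: complexI; rewrite -normE normfV !normE fmorphV. Qed.

Lemma rnorm_real (x : R) : rnorm x%:C = `|x|.
Proof. by rewrite /rnorm normc_def /= expr0n /= addr0 sqrtr_sqr. Qed.

Lemma rnorm_is_norm (X : completeNormedModType R[i]) : is_norm (@rnorm R X).
Proof.
split; [exact: rnorm_ge0|exact: rnorm_eq0|exact: ler_rnormD|exact: rnormZ].
Qed.

End RealNorm.

(** * Cut-off resolvent expansions and the balance of errors *)

Section Iterates.
Variables (R : realType) (X : completeNormedModType R[i]).
Implicit Types (T S : {linear X -> X}) (f g : X) (z : R[i]).

Lemma iterZ T n z f : iter n T (z *: f) = z *: iter n T f.
Proof. by elim: n => //= n ->; rewrite linearZ. Qed.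

Lemma iterB T n f g : iter n T (f - g) = iter n T f - iter n T g.
Proof. by elim: n => //= n ->; rewrite linearB. Qed.

Lemma iter_eigen T n z f : T f = z *: f -> iter n T f = z ^+ n *: f.
Proof.
move=> Tf; elim: n => [|n IH] /=; first by rewrite expr0 scale1r.
by rewrite IH linearZ /= Tf scalerA exprSr.
Qed.

(** A resolvent of [T] commutes with [T]. *)
Lemma iter_resolvent T z S n g : is_resolvent T z S ->
  iter n T (S g) = S (iter n T g).
Proof.
move=> [_ Sl Sr].
have TS h : T (S h) = S (T h).
  by rewrite -[LHS](Sl (T (S h))) -linearZ_LR -(linearB T) Sr.
by elim: n => //= n ->; rewrite TS.
Qed.

(** With [g = z f - T f], the telescoped identity
    [f = z^-n T^n f + sum_(k < n) z^-(k+1) T^k g] is estimated term by term; the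
    geometric sum of [A^k / r^(k+1)] is at most [(A/r)^n / (A - r)] because
    [r < A]. *)
Lemma orbit_bound (nu : X -> R) T z f g (c A r : R) n :
  is_norm nu -> 0 < r < A -> r <= rnorm z -> g = z *: f - T f ->
  (forall k, nu (iter k T g) <= c * A ^+ k) ->
  nu f <= (r ^+ n)^-1 * nu (iter n T f) + c / (A - r) * (A / r) ^+ n.
Proof.
move=> [nu0 _ nuD nuZ] /andP[r0 rA] rz gE hg.
have c0 : 0 <= c by apply: le_trans (nu0 g) _; have := hg 0%N; rewrite expr0 mulr1.
have Ar : 0 < A - r by rewrite subr_gt0.
elim: n => [|n IH].
  rewrite !expr0 invr1 mul1r mulr1 /= lerDl divr_ge0 //; exact: ltW.
apply: le_trans IH _.
have zT : z *: iter n T f = iter n.+1 T f + iter n T g.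
  by rewrite gE iterB iterZ iterSr addrC subrK.
have h : nu (iter n T f) <= r^-1 * (nu (iter n.+1 T f) + c * A ^+ n).
  rewrite mulrC ler_pdivlMr // mulrC.
  apply: le_trans (_ : rnorm z * nu (iter n T f) <= _).
    exact: ler_wpM2r.
  by rewrite -nuZ zT; apply: le_trans (nuD _ _) _; rewrite lerD2l.
have rn0 : 0 < (r ^+ n)^-1 by rewrite invr_gt0 exprn_gt0.
apply: le_trans (_ : (r ^+ n)^-1 * (r^-1 * (nu (iter n.+1 T f) + c * A ^+ n)) +
   c / (A - r) * (A / r) ^+ n <= _).
  by rewrite lerD2r ler_wpM2l // ltW.
rewrite le_eqVlt; apply/orP; left; apply/eqP.
rewrite exprS invfM !exprMn !exprS !exprVn.
have rn : r ^+ n != 0 by rewrite gt_eqF ?exprn_gt0.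
field; rewrite rn !gt_eqF //.
Qed.
End Iterates.

(** The largest [m] with [(A/a)^m <= 1/t] works: then [(A/r)^m t <= (a/r)^m], and
    since [r/a = (A/a)^eta], the maximality of [m] turns into
    [(a/r)^(m+1) <= t^eta]. *)
Lemma geometric_balance (R : realType) (a r A t : R) : 0 < a < r -> r < A -> 0 < t <= 1 ->
  exists m, (a / r) ^+ m <= r / a * t `^ (ln (r / a) / ln (A / a)) /\
            (A / r) ^+ m * t <= r / a * t `^ (ln (r / a) / ln (A / a)).
Proof.
move=> /andP[a0 ar] rA /andP[t0 t1]; set eta := ln _ / _.
have r0 : 0 < r := lt_trans a0 ar; have A0 : 0 < A := lt_trans r0 rA.
have ra1 : 1 < r / a by rewrite ltr_pdivlMr // mul1r.
have Aa1 : 1 < A / a by rewrite ltr_pdivlMr // mul1r (lt_trans ar).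
have Aa0 : 0 < A / a by lra.
have lA : 0 < ln (A / a) by rewrite ln_gt0.
have eta0 : 0 < eta by rewrite divr_gt0 ?ln_gt0.
have raE : r / a = (A / a) `^ eta.
  rewrite /powR ifF /eta; last by rewrite gt_eqF.
  by rewrite divfK ?gt_eqF // lnK // posrE; lra.
have [k kt] : exists k, t^-1 < (A / a) ^+ k.
  pose b := ln t^-1 / ln (A / a).
  exists (Num.truncn b).+1.
  have b0 : 0 <= b by apply: divr_ge0 (ltW lA); rewrite ln_ge0 // invf_ge1.
  have : b < (Num.truncn b).+1%:R by exact: truncnS_gt.
  rewrite ltr_pdivrMr // mulr_natl -lnXn // ltr_ln ?posrE ?invr_gt0 ?exprn_gt0 //.
case: (ex_minnP (ex_intro (fun k => t^-1 < (A / a) ^+ k) k kt)) => {k kt} [[|m]] km kmin.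
  by move: km; rewrite expr0 invf_lt1 // ltNge t1.
have mt : (A / a) ^+ m <= t^-1 by rewrite leNgt; apply/negP => /kmin; rewrite ltnn.
have h1 : (a / r) ^+ m <= r / a * t `^ eta.
  have -> : (a / r) ^+ m = r / a * ((r / a) ^+ m.+1)^-1.
    rewrite exprS !exprMn !exprVn.
    have ? : a ^+ m != 0 by rewrite gt_eqF ?exprn_gt0.
    have ? : r ^+ m != 0 by rewrite gt_eqF ?exprn_gt0.
    by field; rewrite !gt_eqF ?exprn_gt0.
  apply: ler_wpM2l; first lra.
  have -> : (r / a) ^+ m.+1 = ((A / a) ^+ m.+1) `^ eta.
    rewrite raE -powR_mulrn ?powR_ge0 // -powRrM (mulrC eta) powRrM powR_mulrn ?(ltW Aa0) //.
  rewrite -powRN -mulN1r powRrM powR_inv1 ?exprn_ge0 ?(ltW Aa0) //.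
  apply: ge0_ler_powR; rewrite ?nnegrE ?invr_ge0 ?exprn_ge0 ?(ltW Aa0) ?(ltW eta0) ?(ltW t0) //.
  by rewrite -(invrK t) lef_pV2 ?posrE ?invr_gt0 ?exprn_gt0 // ltW.
exists m; split=> //; apply: le_trans h1.
have -> : (A / r) ^+ m = (A / a) ^+ m * (a / r) ^+ m.
  by rewrite -exprMn; congr (_ ^+ _); field; rewrite !gt_eqF.
rewrite mulrAC -[leRHS]mul1r ler_wpM2r ?exprn_ge0 ?divr_ge0 ?(ltW a0) ?(ltW r0) //.
by rewrite -ler_pdivlMr // mul1r.
Qed.

(** * Perturbations that are small in the mixed norm *)

Lemma expr_small (R : realType) (q e : R) : 0 <= q < 1 -> 0 < e ->
  exists n, q ^+ n <= e.
Proof.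
move=> /andP[q0 q1] e0.
have q1' : `|q| < 1 by rewrite ger0_norm.
have /cvgrPdist_lt/(_ _ e0)[N _ hN] := cvg_expr q1'.
by exists N; have := hN _ (leqnn N); rewrite sub0r normrN ger0_norm ?exprn_ge0 // => /ltW.
Qed.

Definition lasota_yorke (R : realType) (X : completeNormedModType R[i])
    (w : X -> R) (C1 C2 C3 a A : R) (T : X -> X) :=
  forall f n, w (iter n T f) <= C1 * A ^+ n * w f /\
    rnorm (iter n T f) <= C2 * a ^+ n * rnorm f + C3 * A ^+ n * w f.

Section Perturbation.
Variables (R : realType) (X : completeNormedModType R[i]) (w : X -> R).
Hypotheses (w_norm : is_norm w) (w_le : forall f, w f <= rnorm f).
Variables (C1 C2 C3 a A r : R).
Hypotheses (C1_gt0 : 0 < C1) (C2_gt0 : 0 < C2) (C3_gt0 : 0 < C3).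
Hypotheses (a_gt0 : 0 < a) (ar : a < r) (rA : r < A).
Implicit Types (S T : {linear X -> X}) (f g : X) (z : R[i]) (H t : R).

Local Notation LY := (lasota_yorke w C1 C2 C3 a A).
Local Notation eta := (ln (r / a) / ln (A / a)).

Let w_ge0 f : 0 <= w f. Proof. by case: w_norm. Qed.
Let r_gt0 : 0 < r. Proof. exact: lt_trans ar. Qed.
Let A_gt0 : 0 < A. Proof. exact: lt_trans rA. Qed.
Let rA_gt0 : 0 < A - r. Proof. by rewrite subr_gt0. Qed.

Lemma lasota_yorke_iter T f n : LY T ->
  rnorm (iter n T f) <= (C2 + C3) * rnorm f * A ^+ n.
Proof.
move=> hT; apply: le_trans (hT f n).2 _.
have aAn : a ^+ n <= A ^+ n.
  by rewrite lerXn2r ?nnegrE ?(ltW a_gt0) ?(ltW A_gt0) // ltW // (lt_trans ar).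
have := rnorm_ge0 f; have := w_le f; have := exprn_ge0 n (ltW A_gt0).
move: aAn (w_ge0 f) (exprn_ge0 n (ltW a_gt0)).
move: (a ^+ n) (A ^+ n) (rnorm f) (w f) => x y u v *.
have : C2 * (x * u) <= C2 * (y * u) by rewrite ler_wpM2l ?ler_wpM2r // ltW.
have : C3 * (y * v) <= C3 * (y * u) by rewrite ler_wpM2l ?ler_wpM2l // ltW.
lra.
Qed.

Lemma lasota_yorke_bounded T f : LY T -> rnorm (T f) <= (C2 + C3) * A * rnorm f.
Proof. by move=> /(@lasota_yorke_iter T f 1); rewrite /= expr1 mulrAC. Qed.

Lemma iter_rate n (x : R) : (r ^+ n)^-1 * (x ^+ n) = (x / r) ^+ n.
Proof. by rewrite mulrC exprMn exprVn. Qed.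

(** As [S] commutes with [T], the term [T^m (S g)] in the expansion of [S g] equals
    [S (T^m g)]; the Lasota-Yorke inequality is thus applied to [g], whose weak norm
    is small in the applications, and not to [S g]. *)
Lemma resolvent_weak_bound T S z H m g : LY T -> r <= rnorm z -> 0 <= H ->
  is_resolvent T z S -> (forall f, rnorm (S f) <= H * rnorm f) ->
  w (S g) <= H * C2 * (a / r) ^+ m * rnorm g +
             (H * C3 + C1 / (A - r)) * (A / r) ^+ m * w g.
Proof.
move=> hT rz H0 hS SH.
have := @orbit_bound _ _ w T z (S g) g (C1 * w g) A r m w_norm.
rewrite r_gt0 rA => /(_ erefl rz).
case: (hS) => _ _ -> /(_ erefl) h.
apply: le_trans (h _) _ => [k|].
  by rewrite mulrAC; exact: (hT g k).1.
rewrite (iter_resolvent _ _ hS).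
have h1 : w (S (iter m T g)) <= H * (C2 * a ^+ m * rnorm g + C3 * A ^+ m * w g).
  apply: le_trans (w_le _) _; apply: le_trans (SH _) _.
  by rewrite ler_wpM2l //; exact: (hT g m).2.
have rm0 : 0 <= (r ^+ m)^-1 by rewrite invr_ge0 exprn_ge0 // ltW.
have := ler_wpM2l rm0 h1.
rewrite -!iter_rate; lra.
Qed.

Definition weak_const := ((C2 + C3) * A * 2 * C2 + C3 + C1 / (A - r)) * (r / a).

Lemma weak_const_gt0 : 0 < weak_const.
Proof.
have h1 : 0 < (C2 + C3) * A * 2 * C2 by rewrite !mulr_gt0 // addr_gt0.
have h2 : 0 < C1 / (A - r) by rewrite divr_gt0.
by rewrite mulr_gt0 ?divr_gt0 // addr_gt0 ?addr_gt0.
Qed.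

(** The strong norm of [(T1 - T0) f] is of order 1 and its weak norm of order [t];
    [geometric_balance] provides the cut-off in [resolvent_weak_bound] for which
    the two contributions have the same size. *)
Lemma resolvent_difference_weak T0 T1 S z H t f : LY T0 -> LY T1 ->
  r <= rnorm z -> 1 <= H -> is_resolvent T0 z S ->
  (forall f, rnorm (S f) <= H * rnorm f) -> 0 < t <= 1 ->
  (forall f, w (T1 f - T0 f) <= t * rnorm f) ->
  w (S (T1 f - T0 f)) <= weak_const * H * t `^ eta * rnorm f.
Proof.
move=> h0 h1 rz H1 hS SH ht hw.
have ar' : 0 < a < r by rewrite a_gt0.
have [m [m1 m2]] := geometric_balance ar' rA ht.
have H0 : 0 <= H by lra.
apply: le_trans (resolvent_weak_bound m _ h0 rz H0 hS SH) _.
have g1 : rnorm (T1 f - T0 f) <= (C2 + C3) * A * 2 * rnorm f.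
  apply: le_trans (ler_rnormB _ _) _.
  have := lasota_yorke_bounded f h0; have := lasota_yorke_bounded f h1; lra.
have b1 : (a / r) ^+ m * rnorm (T1 f - T0 f) <=
    r / a * t `^ eta * ((C2 + C3) * A * 2 * rnorm f).
  by apply: ler_pM => //; rewrite ?rnorm_ge0 // exprn_ge0 // divr_ge0 // ltW.
have b2 : (A / r) ^+ m * w (T1 f - T0 f) <= r / a * t `^ eta * rnorm f.
  apply: le_trans (_ : (A / r) ^+ m * t * rnorm f <= _).
    by rewrite -mulrA ler_wpM2l // exprn_ge0 // divr_ge0 // ltW.
  by rewrite ler_wpM2r // rnorm_ge0.
have HC2 : 0 <= H * C2 by rewrite mulr_ge0 // ltW.
have CA : 0 <= C1 / (A - r) by rewrite divr_ge0 // ltW.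
have HC3 : 0 <= H * C3 + C1 / (A - r) by rewrite addr_ge0 // mulr_ge0 // ltW.
have := lerD (ler_wpM2l HC2 b1) (ler_wpM2l HC3 b2).
rewrite !mulrA => /le_trans; apply.
have : 0 <= (H - 1) * (C1 / (A - r)) * (r / a * t `^ eta * rnorm f).
  by rewrite !mulr_ge0 ?rnorm_ge0 ?powR_ge0 ?invr_ge0 ?subr_ge0 // ltW.
rewrite /weak_const; lra.
Qed.

(** The strong norm of [f] is at most a quarter of itself plus a constant times
    [w f] and the norm of [z f - T1 f], by [orbit_bound] with a cut-off [n] that
    depends on the constants alone.  Writing
    [f = S (z f - T1 f) + S ((T1 - T0) f)] bounds [w f], and the smallness of
    [H t^eta] makes the second term cost another quarter.  The constants [c] and
    [D] do not depend on the operators, on [z] or on [H]. *)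
Lemma perturbed_lower_bound : exists c D : R, [/\ 0 < c, 0 < D &
  forall T0 T1 S z H t f, LY T0 -> LY T1 ->
  r <= rnorm z -> 1 <= H -> is_resolvent T0 z S ->
  (forall f, rnorm (S f) <= H * rnorm f) -> 0 < t <= 1 ->
  (forall f, w (T1 f - T0 f) <= t * rnorm f) ->
  H * t `^ eta <= c -> rnorm f <= D * H * rnorm (z *: f - T1 f)].
Proof.
have ar1 : 0 <= a / r < 1.
  by rewrite divr_ge0 ?(ltW a_gt0) ?(ltW r_gt0) //= ltr_pdivrMr // mul1r.
have [|n hn] := @expr_small _ (a / r) (4 * C2)^-1 ar1.
  by rewrite invr_gt0 mulr_gt0.
have {}hn : C2 * (a / r) ^+ n <= 4^-1.
  have := ler_wpM2l (ltW C2_gt0) hn.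
  by rewrite invfM [leRHS]mulrCA mulfV ?mulr1 // gt_eqF.
set q := (A / r) ^+ n.
have q0 : 0 < q by rewrite exprn_gt0 // divr_gt0.
pose D := 2 * (C3 * q + (C2 + C3) / (A - r) * q).
have CC0 : 0 < (C2 + C3) / (A - r) * q by rewrite mulr_gt0 // divr_gt0 // addr_gt0.
have Cq : 0 < C3 * q by rewrite mulr_gt0.
(* C3 q weak_const is the total coefficient of H t^eta in front of the norm of f. *)
exists (4 * (C3 * q * weak_const))^-1, D; split.
- by rewrite invr_gt0 mulr_gt0 // mulr_gt0 // weak_const_gt0.
- by rewrite /D; lra.
move=> T0 T1 S z H t f h0 h1 rz H1 hS SH ht hw hc.
set g := z *: f - T1 f.
have r0A : 0 < r < A by rewrite r_gt0.
have := orbit_bound n (rnorm_is_norm X) r0A rz (erefl g) (fun k => lasota_yorke_iter g k h1).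
have rn0 : 0 <= (r ^+ n)^-1 by rewrite invr_ge0 exprn_ge0 // ltW.
have := ler_wpM2l rn0 (h1 f n).2.
have -> : (r ^+ n)^-1 * (C2 * a ^+ n * rnorm f + C3 * A ^+ n * w f) =
  C2 * (a / r) ^+ n * rnorm f + C3 * q * w f.
  rewrite /q -!iter_rate; lra.
have wf : w f <= H * rnorm g + weak_const * H * t `^ eta * rnorm f.
  have fE : f = S g + S (T1 f - T0 f).
    rewrite -linearD /g addrA subrK; by case: hS => _ ->.
  case: w_norm => _ _ wD _; rewrite {1}fE; apply: le_trans (wD _ _) _.
  apply: lerD; first by apply: le_trans (w_le _) _.
  exact: (resolvent_difference_weak f h0 h1 rz H1 hS SH ht hw).
have := ler_wpM2l (ltW Cq) wf.
have f0 := rnorm_ge0 f; have g0 := rnorm_ge0 g.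
have k1 : C2 * (a / r) ^+ n * rnorm f <= 4^-1 * rnorm f by exact: ler_wpM2r.
have k2 : C3 * q * weak_const * (H * t `^ eta) * rnorm f <= 4^-1 * rnorm f.
  apply: ler_wpM2r => //.
  have K0 : 0 < C3 * q * weak_const by rewrite mulr_gt0 // weak_const_gt0.
  by have := ler_wpM2l (ltW K0) hc; rewrite invfM [leRHS]mulrCA mulfV ?mulr1 // gt_eqF.
have k3 : (C2 + C3) / (A - r) * q * rnorm g <= (C2 + C3) / (A - r) * q * H * rnorm g.
  by rewrite ler_wpM2r // ler_peMr // ltW.
rewrite /D -/q; move: k1 k2 k3.
lra.
Qed.
End Perturbation.

(** * Invertibility from a lower bound *)

Lemma rnorm_complete (R : realType) (X : completeNormedModType R[i]) (u : nat -> X) :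
  (forall e : R, 0 < e -> exists N, forall n m, (N <= n)%N -> (N <= m)%N ->
     rnorm (u n - u m) < e) ->
  exists l, forall e : R, 0 < e -> exists N, forall n, (N <= n)%N -> rnorm (l - u n) < e.
Proof.
move=> hu.
have : cauchy (u @ \oo).
  apply: cauchy_exP => e e0.
  have [k ek] : exists k : R, e = k%:C by exists (complex.Re e); rewrite RRe_real // gtr0_real.
  have k0 : 0 < k by rewrite -ltcR -ek.
  have [N hN] := hu k k0; exists (u N), N => // n /= Nn.
  by rewrite -ball_normE /ball_ /= normE ek ltcR hN.
move=> /cauchy_cvgP /cvg_ex [l hl]; exists l => e e0.
have e0' : 0 < e%:C by rewrite ltcR.
have /cvgrPdist_lt/(_ _ e0') [N _ hN] := hl.
by exists N => n /hN; rewrite /= normE ltcR.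
Qed.

Section Invertibility.
Variables (R : realType) (X : completeNormedModType R[i]).
Implicit Types (T S : {linear X -> X}) (f g : X) (z : R[i]).

Lemma bounded_op_pos (T : X -> X) : bounded_op T ->
  exists2 M : R, 0 < M & forall f, rnorm (T f) <= M * rnorm f.
Proof.
move=> [M hM]; exists (Num.max M 1); first by rewrite lt_max ltr01 orbT.
move=> f; apply: le_trans (hM f) _.
by rewrite ler_wpM2r ?rnorm_ge0 // le_max lexx.
Qed.

(** The lower bound makes [z - T] injective, so that only a range that is not dense
    could remain as an obstruction, and this is the residual case.  A preimage of
    any [y] is the limit of approximate preimages: the lower bound makes them a
    Cauchy sequence. *)
Lemma nonresidual_lower_bound T z (M : R) : bounded_op T ->
  (forall f, rnorm f <= M * rnorm (z *: f - T f)) ->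
  ~ residual_spectrum T z -> ~ spectrum T z.
Proof.
move=> /bounded_op_pos[B B0 hB] hM nres sp.
pose Q f := z *: f - T f.
have QB f g : Q (f - g) = Q f - Q g.
  by rewrite /Q scalerBr linearB /= !opprD addrACA.
have Qinj : injective Q.
  move=> f g fg; apply/subr0_eq/rnorm_eq0/eqP; rewrite eq_le rnorm_ge0 andbT.
  by apply: le_trans (hM _) _; rewrite -/(Q _) QB fg subrr rnorm0 mulr0.
have M0 : 0 < Num.max M 1 by rewrite lt_max ltr01 orbT.
have {}hM f : rnorm f <= Num.max M 1 * rnorm (Q f).
  apply: le_trans (hM f) _.
  by rewrite ler_wpM2r ?rnorm_ge0 // le_max lexx.
move: (Num.max M 1) M0 hM => {}M M0 hM.
have Qdense : dense (range Q) by apply: contrapT => nd; exact: nres.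
have QT f : rnorm (Q f) <= (rnorm z + B) * rnorm f.
  apply: le_trans (ler_rnormB _ _) _; rewrite rnormZ mulrDl lerD2l; exact: hB.
have approx (y : X) (e : R) : 0 < e -> exists x, rnorm (y - Q x) < e.
  move=> e0; have e0' : 0 < e%:C by rewrite ltcR.
  have [||v [/= hv [x _ xv]]] := Qdense (ball y e%:C).
  - by exists y; exact: ballxx.
  - exact: ball_open.
  by exists x; move: hv; rewrite -ball_normE /ball_ /= normE ltcR xv.
have surj y : exists x, Q x = y.
  have /choice[x hx] : forall n : nat, exists x, rnorm (y - Q x) < n.+1%:R^-1.
    by move=> n; apply: approx; rewrite invr_gt0.
  have small (e : R) : 0 < e -> exists N, forall n, (N <= n)%N -> rnorm (y - Q (x n)) < e.
    move=> e0; exists (Num.truncn e^-1) => n Nn; apply: lt_le_trans (hx n) _.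
    rewrite -[leRHS]invrK lef_pV2 ?posrE ?invr_gt0 //.
    by apply: ltW; apply: lt_le_trans (truncnS_gt _) _; rewrite ler_nat ltnS.
  have [|l hl] := @rnorm_complete _ _ x.
    move=> e e0; have [|N hN] := small (e / (2 * M)); first by rewrite divr_gt0 // mulr_gt0.
    exists N => n m /hN hn /hN hm.
    apply: le_lt_trans (hM _) _.
    rewrite QB -[Q (x n)](subrK y) -addrA.
    apply: le_lt_trans (_ : M * (rnorm (y - Q (x n)) + rnorm (y - Q (x m))) < _).
      by rewrite ler_wpM2l ?(ltW M0) // [rnorm (y - Q (x n))]rnormBC ler_rnormD.
    rewrite mulrC -ltr_pdivlMr //.
    have -> : e / M = e / (2 * M) + e / (2 * M) by field; rewrite gt_eqF.
    exact: ltrD.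
  exists l; apply/subr0_eq/rnorm_eq0/eqP; rewrite eq_le rnorm_ge0 andbT.
  rewrite leNgt; apply/negP => e0; set e := rnorm _ in e0.
  have zB : 0 < rnorm z + B by rewrite ltr_wpDl ?rnorm_ge0.
  have [|N1 h1] := hl (e / (2 * (rnorm z + B))); first by rewrite divr_gt0 // mulr_gt0.
  have [|N2 h2] := small (e / 2); first by rewrite divr_gt0.
  have {}h1 := h1 _ (leq_maxl N1 N2); have {}h2 := h2 _ (leq_maxr N1 N2).
  set n := maxn N1 N2 in h1 h2.
  have : e <= rnorm (Q (l - x n)) + rnorm (y - Q (x n)).
    rewrite /e QB (_ : Q l - y = (Q l - Q (x n)) - (y - Q (x n))) ?ler_rnormB //.
    by move: (Q l) (Q (x n)) => ql qx; rewrite opprB addrA subrK.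
  have := QT (l - x n).
  have : (rnorm z + B) * rnorm (l - x n) < e / 2.
    rewrite mulrC -ltr_pdivlMr //; move: h1; congr (_ < _).
    by field; rewrite gt_eqF.
  lra.
have [S hS] := choice surj.
have linS : linear S.
  move=> c u v; apply: Qinj; rewrite hS.
  have -> : Q (c *: S u + S v) = c *: Q (S u) + Q (S v).
    rewrite /Q (linearP T) [z *: (_ + _)]scalerDr scalerA [z * c]mulrC -scalerA.
    by rewrite opprD addrACA -scalerBr.
  by rewrite !hS.
pose S' : {linear X -> X} := HB.pack S (GRing.isLinear.Build _ _ _ _ S linS).
apply: sp; exists S'; split.
- by exists M => f; apply: le_trans (hM _) _; rewrite hS.
- by move=> f; apply: Qinj; rewrite hS.
- by move=> f; exact: hS.
Qed.
End Invertibility.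

(** * Estimates near a pole of the resolvent *)

Section Poles.
Variables (R : realType) (X : completeNormedModType R[i]).
Implicit Types (T S L : {linear X -> X}) (f g : X) (z lam : R[i]).

(** The supremum over the unit ball dominates each value only when the set of
    values is bounded, whence the assumption on [M]. *)
Lemma le_onorm (w : X -> R) (T : X -> X) (M : R) f :
  is_norm w -> (forall c f, T (c *: f) = c *: T f) ->
  (forall f, w (T f) <= M * rnorm f) -> w (T f) <= onorm w T * rnorm f.
Proof.
move=> [w0 _ _ wZ] TZ hM.
have [->|f0] := eqVneq f 0.
  by rewrite -(scale0r (0 : X)) TZ wZ rnormZ !rnorm0 !mul0r mulr0.
have nf := rnorm_gt0 f0.
set g := (rnorm f)^-1%:C *: f.
have g1 : rnorm g = 1.
  by rewrite /g rnormZ rnorm_real ger0_norm ?invr_ge0 ?(ltW nf) // mulVf // gt_eqF.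
have fE : f = (rnorm f)%:C *: g.
  by rewrite /g scalerA -rmorphM /= mulfV ?scale1r // gt_eqF.
rewrite {1}fE TZ wZ rnorm_real ger0_norm ?(ltW nf) // mulrC ler_wpM2r ?(ltW nf) //.
apply: sup_upper_bound; last by exists g => //=; rewrite g1.
split; first by exists (w (T g)); exists g => //=; rewrite g1.
exists (Num.max M 0) => _ [h /= h1 <-]; apply: le_trans (hM h) _.
apply: le_trans (_ : Num.max M 0 * rnorm h <= _).
  by rewrite ler_wpM2r ?rnorm_ge0 // le_max lexx.
by rewrite ler_piMr // le_max lexx orbT.
Qed.

Lemma rnorm_sum (F : nat -> X) N :
  rnorm (\sum_(n < N) F n) <= \sum_(n < N) rnorm (F n).
Proof.
elim: N => [|N IH]; first by rewrite !big_ord0 rnorm0.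
by rewrite !big_ord_recr /=; apply: le_trans (ler_rnormD _ _) _; rewrite lerD2r.
Qed.

Lemma bounded_op_sub_sum (S : X -> X) (B : nat -> {linear X -> X}) (c : nat -> R[i]) N :
  bounded_op S -> (forall n, bounded_op (B n)) ->
  bounded_op (fun f => S f - \sum_(n < N) c n *: B n f).
Proof.
move=> [M hM] hB; elim: N => [|N [K IH]].
  by exists M => f; rewrite big_ord0 subr0.
have [b hb] := hB N; exists (K + rnorm (c N) * b) => f.
rewrite big_ord_recr /= opprD addrA mulrDl.
apply: le_trans (ler_rnormB _ _) _; apply: lerD => //.
by rewrite rnormZ -mulrA ler_wpM2l ?rnorm_ge0.
Qed.

Lemma le0_linear_small (x K d0 : R) : 0 < d0 ->
  (forall d, 0 < d <= d0 -> x <= K * d) -> x <= 0.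
Proof.
move=> d00 h; rewrite leNgt; apply/negP => x0.
have K0 : 0 < K.
  have : x <= K * d0 by apply: h; rewrite d00 lexx.
  by move=> /(lt_le_trans x0); rewrite pmulr_lgt0.
have := h (Num.min d0 (x / (2 * K))).
rewrite lt_min d00 ge_min lexx divr_gt0 ?mulr_gt0 // => /(_ isT).
apply/negP; rewrite -ltNge.
apply: le_lt_trans (_ : K * (x / (2 * K)) < _).
  by rewrite ler_wpM2l ?(ltW K0) // ge_min lexx orbT.
have -> : K * (x / (2 * K)) = x / 2 by field; rewrite gt_eqF.
lra.
Qed.

(** The terms are dominated by those of a geometric series of ratio at most 1/2,
    whose partial sums are at most twice the first term. *)
Lemma geometric_tail (B : nat -> {linear X -> X}) (M d1 : R) (u : R[i]) f N :
  0 < d1 -> rnorm u <= d1 / 2 -> (forall n f, d1 ^+ n * rnorm (B n f) <= M * rnorm f) ->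
  rnorm (\sum_(n < N) u ^+ n.+1 *: B n.+1 f) <= 2 * (rnorm u / d1) * M * rnorm f.
Proof.
move=> d10 ud hB; set q := rnorm u / d1.
have q0 : 0 <= q by rewrite divr_ge0 ?rnorm_ge0 // ltW.
have q1 : q <= 2^-1 by rewrite ler_pdivrMr // mulrC.
have M0 : 0 <= M * rnorm f.
  by apply: le_trans (hB 0%N f); rewrite mulr_ge0 ?rnorm_ge0 ?exprn_ge0 // ltW.
suff h : rnorm (\sum_(n < N) u ^+ n.+1 *: B n.+1 f) <= 2 * q * (1 - 2^-1 ^+ N) * (M * rnorm f).
  apply: le_trans h _; rewrite -[leRHS]mulrA ler_wpM2r //.
  apply: ler_piMr; first by rewrite mulr_ge0.
  by rewrite lerBlDr lerDl exprn_ge0 // invr_ge0.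
elim: N => [|N IH]; first by rewrite big_ord0 rnorm0 expr0 subrr mulr0 mul0r.
rewrite big_ord_recr /=; apply: le_trans (ler_rnormD _ _) _.
have h : rnorm (u ^+ N.+1 *: B N.+1 f) <= q * 2^-1 ^+ N * (M * rnorm f).
  rewrite rnormZ rnormX.
  have -> : rnorm u = q * d1 by rewrite /q divfK // gt_eqF.
  rewrite exprMn -[leLHS]mulrA; apply: ler_pM; first by rewrite exprn_ge0.
  - by rewrite mulr_ge0 ?rnorm_ge0 // exprn_ge0 // ltW.
  - by rewrite exprS ler_wpM2l // lerXn2r // nnegrE // invr_ge0.
  - exact: hB.
apply: le_trans (lerD IH h) _; rewrite exprS.
move: (2^-1 ^+ N) => x; lra.
Qed.

(** The terms of a series that converges at distance [rho] from the pole are bounded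
    there: for large [n] a term is the difference of two partial sums that are
    within 1 of the limit.  This is a Cauchy estimate for the coefficients. *)
Lemma laurent_coefficient_bound L lam p : resolvent_pole L lam p ->
  exists rho M : R, exists B : nat -> {linear X -> X},
   [/\ 0 < rho, 0 < M, exists f, B 0%N f != 0,
    forall n f, rho ^+ n * rnorm (B n f) <= M * rnorm f
    & forall z, 0 < rnorm (z - lam) <= rho -> exists S, is_resolvent L z S /\
      forall e : R, 0 < e -> exists N0, forall N, (N0 <= N)%N -> forall f,
        rnorm (S f - \sum_(n < N) ((z - lam) ^+ n / (z - lam) ^+ p) *: B n f) <= e * rnorm f].
Proof.
move=> [_ _ [rho' [B [rho0 Bb B0 hz]]]].
pose rho := rho' / 2; have r0 : 0 < rho by rewrite /rho; lra.
have conv z : 0 < rnorm (z - lam) <= rho -> exists S, is_resolvent L z S /\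
      forall e : R, 0 < e -> exists N0, forall N, (N0 <= N)%N -> forall f,
        rnorm (S f - \sum_(n < N) ((z - lam) ^+ n / (z - lam) ^+ p) *: B n f) <= e * rnorm f.
  move=> /andP[z0 zr]; have [|S [hS cS]] := hz z; first by rewrite /rho in zr; lra.
  exists S; split=> // e e0.
  move/cvgrPdist_lt/(_ _ e0): cS => [N0 _ h]; exists N0 => N /h /=.
  rewrite sub0r normrN => {}h f.
  have [K hK] : bounded_op (fun f => S f -
      \sum_(n < N) ((z - lam) ^+ n / (z - lam) ^+ p) *: B n f).
    by case: hS => Sb _ _; exact: (bounded_op_sub_sum (fun n => (z - lam) ^+ n / (z - lam) ^+ p) N Sb Bb).
  apply: le_trans (le_onorm (w := @rnorm R X) f _ _ hK) _; first exact: rnorm_is_norm.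
    move=> c {}f; rewrite linearZ /= scalerBr; congr (_ - _).
    rewrite scaler_sumr; apply: eq_bigr => i _.
    by rewrite linearZ /= !scalerA [c * _]mulrC.
  rewrite ler_wpM2r ?rnorm_ge0 //; exact: le_trans (ler_norm _) (ltW h).
have z1 : rnorm (lam + rho%:C - lam) = rho.
  by rewrite addrAC subrr add0r rnorm_real ger0_norm // ltW.
have [|S [_ hS]] := conv (lam + rho%:C); first by rewrite z1 r0 lexx.
have [N0 hN0] := hS 1 ltr01.
have /choice[b hb] : forall n, exists b : R, 0 < b /\ forall f, rnorm (B n f) <= b * rnorm f.
  by move=> n; have [b b0 hb] := bounded_op_pos (Bb n); exists b.
pose M := 2 * rho ^+ p + \sum_(n < N0) rho ^+ n * b n.
have rp : 0 < 2 * rho ^+ p by rewrite mulr_gt0 // exprn_gt0.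
have s0 (P : pred 'I_N0) : 0 <= \sum_(n < N0 | P n) rho ^+ n * b n.
  by apply: sumr_ge0 => i _; rewrite mulr_ge0 ?exprn_ge0 ?(ltW r0) // ltW // (hb i).1.
exists rho, M, B; split => //; first by rewrite /M ltr_pwDl.
move=> n f; case: (ltnP n N0) => [nN|Nn].
  apply: le_trans (_ : (rho ^+ n * b n) * rnorm f <= _).
    by rewrite -mulrA ler_wpM2l ?exprn_ge0 ?(ltW r0) // (hb n).2.
  rewrite ler_wpM2r ?rnorm_ge0 // /M (bigD1 (Ordinal nN)) //=.
  have := s0 (fun i => i != Ordinal nN); lra.
have h1 := hN0 _ Nn f; have h2 := hN0 _ (leqW Nn) f.
rewrite big_ord_recr /= in h2; move: h1 h2.
set s := \sum_(i < n) _; set t := _ *: B n f => h1 h2.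
have h : rnorm t <= 2 * rnorm f.
  have -> : t = (S f - s) - (S f - (s + t)) by rewrite opprB !addrA subrK addrAC subrr add0r.
  apply: le_trans (ler_rnormB _ _) _; lra.
have tE : rnorm t = rho ^+ n / rho ^+ p * rnorm (B n f).
  by rewrite /t rnormZ rnormM rnormV !rnormX z1.
have -> : rho ^+ n * rnorm (B n f) = rho ^+ p * rnorm t.
  by rewrite tE; field; rewrite gt_eqF // exprn_gt0.
apply: le_trans (_ : 2 * rho ^+ p * rnorm f <= _).
  by rewrite [2 * _]mulrC -mulrA ler_wpM2l // exprn_ge0 // ltW.
by rewrite ler_wpM2r ?rnorm_ge0 // /M lerDl.
Qed.

(** By [geometric_tail], [(z - lam)^p S f] differs from [B 0 f] by [O(|z - lam|)].
    So it is bounded, which is the estimate of [S]; and as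
    [(z - L) ((z - lam)^p S f) = (z - lam)^p f] tends to [0], [B 0 f] is an
    eigenvector. *)
Lemma pole_estimates L lam p : bounded_op L -> resolvent_pole L lam p ->
  exists d0 C : R, exists g, [/\ 0 < d0, 0 < C, g != 0, L g = lam *: g &
    forall z, 0 < rnorm (z - lam) <= d0 -> exists S, is_resolvent L z S /\
      forall f, rnorm (S f) <= C / rnorm (z - lam) ^+ p * rnorm f].
Proof.
move=> /bounded_op_pos[ML ML0 hL] hpole; have [p0 _ _] := hpole.
have [rho [M [B [r0 M0 [f0 Bf0] hB hz]]]] := laurent_coefficient_bound hpole.
have lead z : 0 < rnorm (z - lam) <= rho / 2 -> exists S, is_resolvent L z S /\
    forall f, rnorm ((z - lam) ^+ p *: S f - B 0%N f) <=
      3 * (rnorm (z - lam) / rho) * M * rnorm f.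
  move=> /andP[z0 zr]; have [|S [hS cS]] := hz z; first by lra.
  exists S; split=> // f; set u := z - lam in z0 zr cS *; set q := rnorm u / rho.
  have up : 0 < rnorm u ^+ p by rewrite exprn_gt0.
  have un0 : u ^+ p != 0 by apply: contraTneq up; rewrite -rnormX => ->; rewrite rnorm0 ltxx.
  have [|N hN] := cS (q * M / rnorm u ^+ p); first by rewrite divr_gt0 // mulr_gt0 // divr_gt0.
  have := hN N.+1 (leqnSn N) f; set s := \sum_(n < N.+1) _ => h.
  have sE : u ^+ p *: s = B 0%N f + \sum_(n < N) u ^+ n.+1 *: B n.+1 f.
    rewrite /s scaler_sumr big_ord_recl /= expr0 scalerA mulrCA mulfV // mulr1 scale1r.
    congr (_ + _); apply: eq_bigr => i _.
    by rewrite scalerA mulrCA mulfV // mulr1.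
  have -> : u ^+ p *: S f - B 0%N f = u ^+ p *: (S f - s) + \sum_(n < N) u ^+ n.+1 *: B n.+1 f.
    by rewrite scalerBr sE opprD addrA subrK.
  apply: le_trans (ler_rnormD _ _) _.
  have h1 := geometric_tail f N r0 zr hB.
  have h2 : rnorm (u ^+ p *: (S f - s)) <= q * M * rnorm f.
    rewrite rnormZ rnormX; apply: le_trans (ler_wpM2l (ltW up) h) _.
    by rewrite mulrA [leLHS](_ : _ = q * M * rnorm f) //; field; rewrite gt_eqF.
  rewrite -/q in h1; lra.
exists (rho / 2), (3 * M), (B 0%N f0); split => //; [lra|lra| |].
  apply/subr0_eq/rnorm_eq0/eqP; rewrite eq_le rnorm_ge0 andbT.
  pose Z := rnorm lam + 1.
  pose K := rnorm (B 0%N f0) + (Z + ML) * (3 / rho * M * rnorm f0) + rnorm f0.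
  have m0 : 0 < Num.min 1 (rho / 2) by rewrite lt_min ltr01 divr_gt0.
  apply: (le0_linear_small (K := K) m0) => d /andP[d0 dm].
  have [d1 dr] : d <= 1 /\ d <= rho / 2 by move: dm; rewrite le_min => /andP[].
  have zd : rnorm (lam + d%:C - lam) = d.
    by rewrite addrAC subrr add0r rnorm_real ger0_norm // ltW.
  have [|S [[_ _ SR] hS]] := lead (lam + d%:C); first by rewrite zd d0.
  have {hS} := hS f0; rewrite zd; set z := lam + d%:C in zd SR *.
  have -> : z - lam = d%:C by rewrite /z addrAC subrr add0r.
  set h := B 0%N f0; set v := d%:C ^+ p *: S f0 => hv.
  have Qv : z *: v - L v = d%:C ^+ p *: f0.
    by rewrite /v [L _]linearZ /= !scalerA [z * _]mulrC -!scalerA -scalerBr SR.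
  have e1 : L h - lam *: h = d%:C *: h + (z *: (v - h) - L (v - h)) - d%:C ^+ p *: f0.
    rewrite -Qv scalerBr [L (v - h)]linearB /= [z *: h]scalerDl.
    move: (L v) (L h) (lam *: h) (z *: v) (d%:C *: h) => b Lh lh a dh.
    rewrite opprB [Lh - b]addrC addrACA [dh + _]addrCA [a - b + (dh + _)]addrC addrK.
    by rewrite opprD [- lh - dh]addrC !addrA subrr add0r addrC.
  have zZ : rnorm z <= Z.
    by apply: le_trans (ler_rnormD _ _) _; rewrite rnorm_real ger0_norm ?(ltW d0) // lerD2l.
  rewrite e1; apply: le_trans (ler_rnormB _ _) _.
  apply: le_trans (lerD (ler_rnormD _ _) (lexx _)) _.
  rewrite !rnormZ rnormX rnorm_real ger0_norm ?(ltW d0) //.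
  have k1 : d ^+ p * rnorm f0 <= d * rnorm f0.
    rewrite ler_wpM2r ?rnorm_ge0 //; case: (p) p0 => // n _.
    by rewrite exprS ler_piMr ?(ltW d0) // exprn_ile1 // ltW.
  have k2 : rnorm (z *: (v - h) - L (v - h)) <= (Z + ML) * rnorm (v - h).
    apply: le_trans (ler_rnormB _ _) _; rewrite rnormZ mulrDl.
    by apply: lerD (hL _); rewrite ler_wpM2r ?rnorm_ge0.
  have k3 : (Z + ML) * rnorm (v - h) <= (Z + ML) * (3 * (d / rho) * M * rnorm f0).
    by rewrite ler_wpM2l // addr_ge0 ?(ltW ML0) // addr_ge0 // rnorm_ge0.
  have KE : K * d = d * rnorm h + (Z + ML) * (3 * (d / rho) * M * rnorm f0) + d * rnorm f0.
    by rewrite /K -/h; ring.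
  rewrite KE; apply: lerD => //; rewrite lerD2l; exact: le_trans k3.
move=> z /[dup] /andP[z0 zr] /lead [S [hS hl]]; exists S; split=> // f.
have up : 0 < rnorm (z - lam) ^+ p by rewrite exprn_gt0.
rewrite mulrAC ler_pdivlMr // mulrC -rnormX -rnormZ.
rewrite -[_ *: _](subrK (B 0%N f)); apply: le_trans (ler_rnormD _ _) _.
have := hl f; have := hB 0%N f; rewrite expr0 mul1r.
have : 3 * (rnorm (z - lam) / rho) * M * rnorm f <= 2 * M * rnorm f.
  rewrite ler_wpM2r ?rnorm_ge0 // ler_wpM2r ?(ltW M0) //.
  have : rnorm (z - lam) / rho <= 2^-1 by rewrite ler_pdivrMr // mulrC.
  lra.
lra.
Qed.
End Poles.

(** * The mean value property *)

Section MeanValue.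
Variables (R : realType) (X : completeNormedModType R[i]).
Implicit Types (F : R[i] -> X) (u v om : R[i]).

Lemma rnorm_complex_le (x y : R) : rnorm (x +i* y) <= `|x| + `|y|.
Proof.
have -> : x +i* y = x%:C + 'i * y%:C by rewrite [LHS]complexE.
apply: le_trans (ler_rnormD _ _) _; rewrite rnormM !rnorm_real.
by rewrite (_ : rnorm 'i = 1) ?mul1r // /rnorm normc_def /= expr0n expr1n add0r sqrtr1.
Qed.

Lemma rnorm_ge_parts u : `|complex.Re u| <= rnorm u /\ `|complex.Im u| <= rnorm u.
Proof.
rewrite /rnorm normc_def /= -[`|complex.Re u|]sqrtr_sqr -[`|complex.Im u|]sqrtr_sqr.
by split; apply: ler_wsqrtr; rewrite ?lerDl ?lerDr sqr_ge0.
Qed.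

Lemma de_moivre (x : R) n : (cos x +i* sin x) ^+ n = cos (n%:R * x) +i* sin (n%:R * x).
Proof.
elim: n => [|n IH]; first by rewrite expr0 mul0r cos0 sin0.
rewrite exprSr IH -natr1 mulrDl mul1r cosD sinD; simpc.
by congr (_ +i* _); rewrite addrC.
Qed.

Lemma root_of_unity_near1 (e : R) : 0 < e -> exists N, exists om : R[i],
  [/\ (0 < N)%N, om ^+ N = 1, om != 1, rnorm om = 1 & rnorm (om - 1) < e].
Proof.
move=> e0; have e20 : 0 < e / 2 by rewrite divr_gt0.
have /cvgrPdist_lt/(_ _ e20) := @continuous_cos R 0.
have /cvgrPdist_lt/(_ _ e20) := @continuous_sin R 0.
move=> /nbhs_ballP[d1 /= d10 h1] /nbhs_ballP[d2 /= d20 h2].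
have [d [d0 dd1 dd2]] : exists d : R, [/\ 0 < d, d <= d1 & d <= d2].
  by exists (Num.min d1 d2); rewrite lt_min d10 d20 !ge_min !lexx orbT.
pose N := (Num.truncn (2 * pi / d)).+3.
pose x := 2 * pi / N%:R : R.
have p0 := pi_gt0 R.
have N0 : 0 < N%:R :> R by rewrite ltr0n.
have x0 : 0 < x by rewrite divr_gt0 ?mulr_gt0.
have xd : x < d.
  rewrite /x ltr_pdivrMr // [d * _]mulrC -ltr_pdivrMr //.
  by apply: lt_le_trans (truncnS_gt (2 * pi / d)) _; rewrite ler_nat /N leqW.
have xp : x < pi.
  by rewrite /x ltr_pdivrMr // [pi * _]mulrC ltr_pM2r // ltr_nat.
exists N, (cos x +i* sin x); split => //.
- rewrite de_moivre /x mulrCA mulfV ?gt_eqF // mulr1 mulr_natl.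
  by rewrite cos2pi sin2pi.
- by rewrite eq_complex /= negb_and (gt_eqF (sin_gt0_pi _)) ?orbT // x0.
- by rewrite /rnorm normc_def /= cos2Dsin2 sqrtr1.
have -> : cos x +i* sin x - 1 = (cos x - 1) +i* sin x by simpc; rewrite ?subr0.
apply: le_lt_trans (rnorm_complex_le _ _) _.
have {}h1 : `|sin x| < e / 2.
  have := h1 x; rewrite /ball /= sub0r normrN gtr0_norm // sin0 sub0r normrN; apply.
  exact: lt_le_trans dd1.
have {}h2 : `|cos x - 1| < e / 2.
  have := h2 x; rewrite /ball /= sub0r normrN gtr0_norm // cos0 distrC; apply.
  exact: lt_le_trans dd2.
lra.
Qed.

Lemma rnorm_sum_le (G : nat -> X) N (c : R) : (forall j, rnorm (G j) <= c) ->
  rnorm (\sum_(j < N) G j) <= N%:R * c.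
Proof.
move=> h; apply: le_trans (rnorm_sum _ _) _.
apply: le_trans (_ : \sum_(j < N) c <= _); first by apply: ler_sum => j _; exact: h.
by rewrite sumr_const card_ord mulr_natl.
Qed.

Variables (F F' : R[i] -> X) (K s : R).
Hypotheses (s0 : 0 < s) (K0 : 0 <= K).
Hypothesis taylor : forall u v, rnorm u <= s -> rnorm v <= s ->
  rnorm (F u - F v - (u - v) *: F' v) <= K * rnorm (u - v) ^+ 2.

Section Root.
Variables (N : nat) (om : R[i]).
Hypotheses (om1 : om != 1) (omN : om ^+ N = 1) (omn : rnorm om = 1).

Let node (sg : R) j : R[i] := sg%:C * om ^+ j.

Let rnorm_node sg j : 0 <= sg -> rnorm (node sg j) = sg.
Proof. by move=> h; rewrite /node rnormM rnormX omn expr1n mulr1 rnorm_real ger0_norm. Qed.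

(** The sum of the increments of [F] along the polygon is zero.  To first order the
    increment over the [j]-th side is [sg om^j (om - 1) F'(sg om^j)], so the
    remainders bound the whole sum.  This is the discrete form of the vanishing of
    the integral of [F'] along a circle. *)
Lemma circle_derivative (sg : R) : 0 <= sg <= s ->
  rnorm (\sum_(j < N) om ^+ j *: F' (node sg j)) <= N%:R * (K * s * rnorm (om - 1)).
Proof.
move=> /andP[sg0 sgs].
have q0 : 0 < rnorm (om - 1) by apply: rnorm_gt0; rewrite subr_eq0.
set D := \sum_(j < N) _.
move: sg0; rewrite le_eqVlt => /predU1P[sgE|sg0].
  have -> : D = 0.
    have c0 : om - 1 != 0 by rewrite subr_eq0.
    rewrite -[D]scale1r -(mulVf c0) -scalerA.
    rewrite (_ : (om - 1) *: D = 0) ?scaler0 //.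
    rewrite /D scaler_sumr.
    have n0 j : node sg j = 0 by rewrite /node -sgE rmorph0 mul0r.
    under eq_bigr do rewrite n0 scalerA mulrBl mul1r -exprS.
    rewrite -scaler_suml -(big_mkord xpredT (fun j => om ^+ j.+1 - om ^+ j)).
    by rewrite telescope_sumr // omN expr0 subrr scale0r.
  by rewrite rnorm0 !mulr_ge0 // ?(ltW s0) // ltW.
have tel : \sum_(j < N) (F (node sg j.+1) - F (node sg j)) = 0.
  rewrite -(big_mkord xpredT (fun j => F (node sg j.+1) - F (node sg j))).
  by rewrite telescope_sumr // /node omN expr0 subrr.
(* sg om^j (om - 1) is the side from the j-th vertex to the next. *)
have cD : (sg%:C * (om - 1)) *: D = - \sum_(j < N)
    (F (node sg j.+1) - F (node sg j) - (node sg j.+1 - node sg j) *: F' (node sg j)).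
  rewrite sumrB tel sub0r opprK /D scaler_sumr; apply: eq_bigr => j _.
  by rewrite scalerA /node exprS -mulrA mulrBl mul1r mulrBr.
have h : rnorm ((sg%:C * (om - 1)) *: D) <= N%:R * (K * (sg * rnorm (om - 1)) ^+ 2).
  rewrite cD rnormN.
  apply: (rnorm_sum_le (G := fun j => F (node sg j.+1) - F (node sg j) -
            (node sg j.+1 - node sg j) *: F' (node sg j))) => j.
  apply: le_trans (taylor _ _) _; rewrite ?rnorm_node ?(ltW sg0) //.
  rewrite (_ : node sg j.+1 - node sg j = node sg j * (om - 1)).
    by rewrite rnormM rnorm_node // ltW.
  by rewrite /node exprSr mulrBr mulr1 mulrA.
have c0 : 0 < sg * rnorm (om - 1) by rewrite mulr_gt0.
move: h; rewrite rnormZ rnormM rnorm_real gtr0_norm // expr2 mulrA mulrA -[leRHS]mulrC.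
rewrite ler_pM2l // => /le_trans; apply.
by rewrite -mulrA ler_wpM2l // -mulrA ler_wpM2l // ler_wpM2r // ltW.
Qed.

(** To first order the mean changes by [h] times the sum that [circle_derivative]
    bounds. *)
Lemma circle_mean_step (sg h : R) : 0 <= sg -> 0 <= h -> sg + h <= s ->
  rnorm (\sum_(j < N) F (node (sg + h) j) - \sum_(j < N) F (node sg j)) <=
  N%:R * (h * (K * s * rnorm (om - 1)) + K * h ^+ 2).
Proof.
move=> sg0 h0 sgh; rewrite -sumrB.
have dE j : node (sg + h) j - node sg j = h%:C * om ^+ j.
  by rewrite /node -mulrBl rmorphD /= addrAC subrr add0r.
have -> : \sum_(j < N) (F (node (sg + h) j) - F (node sg j)) =
   \sum_(j < N) (F (node (sg + h) j) - F (node sg j) -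
        (node (sg + h) j - node sg j) *: F' (node sg j)) +
   h%:C *: \sum_(j < N) om ^+ j *: F' (node sg j).
  rewrite scaler_sumr -big_split /=; apply: eq_bigr => j _.
  by rewrite dE scalerA subrK.
apply: le_trans (ler_rnormD _ _) _; rewrite addrC mulrDr; apply: lerD.
  rewrite rnormZ rnorm_real ger0_norm // mulrCA ler_wpM2l //.
  by apply: circle_derivative; lra.
apply: (rnorm_sum_le (G := fun j => F (node (sg + h) j) - F (node sg j) -
        (node (sg + h) j - node sg j) *: F' (node sg j))) => j.
apply: le_trans (taylor _ _) _; rewrite ?rnorm_node ?addr_ge0 //; first lra.
by rewrite dE rnormM rnormX omn expr1n mulr1 rnorm_real ger0_norm.
Qed.

Lemma circle_mean_iter (h : R) k : 0 <= h -> k%:R * h <= s ->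
  rnorm (\sum_(j < N) F (node (k%:R * h) j) - F 0 *+ N) <=
  k%:R * (N%:R * (h * (K * s * rnorm (om - 1)) + K * h ^+ 2)).
Proof.
move=> h0; elim: k => [|k IH] hk.
  rewrite !mul0r; under eq_bigr do rewrite /node rmorph0 mul0r.
  by rewrite sumr_const card_ord subrr rnorm0.
have kh : k%:R * h + h = k.+1%:R * h by rewrite -natr1 mulrDl mul1r.
have hk' : k%:R * h <= s by apply: le_trans hk; rewrite -kh lerDl.
have k0 : 0 <= k%:R * h by rewrite mulr_ge0.
rewrite -kh -(subrKA (\sum_(j < N) F (node (k%:R * h) j))) -natr1 mulrDl mul1r addrC.
apply: le_trans (ler_rnormD _ _) _; apply: lerD; first exact: IH.
by apply: circle_mean_step => //; rewrite kh.
Qed.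
End Root.

(** The mean over the polygon of radius [0] is [F 0].  Growing the radius to [s] in
    [n] steps costs at most [K s^2 (|om - 1| + 1/n)] per vertex, and both terms can
    be made small. *)
Lemma mean_value (e : R) : 0 < e -> exists N, exists om : R[i],
  [/\ (0 < N)%N, rnorm om = 1 &
   rnorm (\sum_(j < N) F (s%:C * om ^+ j) - F 0 *+ N) <= N%:R * e].
Proof.
move=> e0; pose b := K * s ^+ 2 + 1.
have b0 : 0 < b by rewrite ltr_pwDr // mulr_ge0 // exprn_ge0 // ltW.
have [|N [om [N0 omN om1 omn hq]]] := @root_of_unity_near1 (e / (2 * b)).
  by rewrite divr_gt0 // mulr_gt0.
exists N, om; split=> //.
pose n := (Num.truncn (2 * b / e)).+1.
have n0 : 0 < n%:R :> R by rewrite ltr0n.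
pose h := s / n%:R.
have nh : n%:R * h = s by rewrite /h mulrCA mulfV ?mulr1 // gt_eqF.
have h0 : 0 <= h by rewrite divr_ge0 // ltW.
have := @circle_mean_iter N om om1 omN omn h n h0; rewrite nh lexx => /(_ isT) /le_trans; apply.
rewrite mulrCA ler_wpM2l //.
have -> : n%:R * (h * (K * s * rnorm (om - 1)) + K * h ^+ 2) =
   K * s ^+ 2 * rnorm (om - 1) + K * s ^+ 2 / n%:R.
  by rewrite /h; field; rewrite gt_eqF.
have h1 : b * rnorm (om - 1) <= e / 2.
  rewrite mulrC -ler_pdivlMr // (_ : e / 2 / b = e / (2 * b)); first exact: ltW.
  by field; rewrite gt_eqF.
have h2 : b / n%:R <= e / 2.
  rewrite ler_pdivrMr // -ler_pdivrMl ?divr_gt0 //.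
  rewrite (_ : (e / 2)^-1 * b = 2 * b / e); first by rewrite ltW // truncnS_gt.
  by field; rewrite gt_eqF.
have q0 : 0 <= rnorm (om - 1) by exact: rnorm_ge0.
have i0 : 0 <= n%:R^-1 :> R by rewrite invr_ge0 ltW.
rewrite /b mulrDl mul1r in h1; rewrite /b mulrDl mul1r in h2; lra.
Qed.
End MeanValue.

(** * Resolvents on a spectrum-free disk *)

Section ResolventOnDisk.
Variables (R : realType) (X : completeNormedModType R[i]).
Implicit Types (T S : {linear X -> X}) (f g : X) (z u v lam : R[i]).

Lemma resolvent_identity T z1 z2 S1 S2 f : is_resolvent T z1 S1 -> is_resolvent T z2 S2 ->
  S1 f = S2 f + (z2 - z1) *: S1 (S2 f).
Proof.
move=> [_ S1l _] [_ _ S2r].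
have fE : f = (z1 *: S2 f - T (S2 f)) + (z2 - z1) *: S2 f.
  by rewrite -[LHS]S2r scalerBl [RHS]addrC subrKA.
by rewrite {1}fE (linearD S1) [S1 (_ *: _)]linearZ S1l.
Qed.

(** A lower bound for [z - T] survives a small change of [z].  Unlike the openness of
    the resolvent set, this needs no Neumann series. *)
Lemma lower_bound_near T z1 z2 f (M : R) : 0 < M -> rnorm (z1 - z2) <= (2 * M)^-1 ->
  rnorm f <= M * rnorm (z1 *: f - T f) -> rnorm f <= 2 * M * rnorm (z2 *: f - T f).
Proof.
move=> M0 zz h1.
have h2 : rnorm (z1 *: f - T f) <= rnorm (z2 *: f - T f) + rnorm (z1 - z2) * rnorm f.
  rewrite -rnormZ (_ : z1 *: f - T f = (z2 *: f - T f) + (z1 - z2) *: f) ?ler_rnormD //.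
  by rewrite scalerBl [RHS]addrC subrKA.
have h3 : M * (rnorm (z1 - z2) * rnorm f) <= 2^-1 * rnorm f.
  rewrite mulrA ler_wpM2r ?rnorm_ge0 //.
  apply: le_trans (ler_wpM2l (ltW M0) zz) _.
  by rewrite invfM mulrCA mulfV ?mulr1 // gt_eqF.
have := ler_wpM2l (ltW M0) h2; lra.
Qed.

(** The disk of radius [s] lies in a square inside the disk of radius [2 s].  Each
    point of the square has a lower bound valid nearby, by [lower_bound_near];
    compactness of the square makes it uniform. *)
Lemma resolvent_bound_on_disk T lam (s : R) : 0 < s ->
  (forall u, rnorm u <= 2 * s -> exists S, is_resolvent T (lam + u) S) ->
  exists2 M : R, 0 < M & forall u f, rnorm u <= s ->
    rnorm f <= M * rnorm ((lam + u) *: f - T f).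
Proof.
move=> s0 hS.
pose P (M : R) (xy : R * R) := forall f,
  rnorm f <= M * rnorm ((lam + (xy.1 +i* xy.2)) *: f - T f).
have cK : compact (`[- s, s]%classic `*` `[- s, s]%classic : set (R * R)).
  by apply: compact_setX; exact: segment_compact.
have [|M [_ hM]] := (compact_near_coveringP _).1 cK R (pinfty_nbhs R) P _.
  move=> [x y] [/= xs ys].
  have [|S [Sb Sl _]] := hS (x +i* y).
    apply: le_trans (rnorm_complex_le _ _) _.
    move: xs ys; rewrite !in_itv /= -!ler_norml; lra.
  have [m m0 hm] := bounded_op_pos Sb.
  pose d := (2 * m)^-1 / 2; have d0 : 0 < d by rewrite divr_gt0 // invr_gt0 mulr_gt0.
  (* The two coordinates each move by half of the distance (2 m)^-1 allowed. *)
  exists (ball x d `*` ball y d, [set M | 2 * m <= M]).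
    split=> /=.
      by exists (ball x d, ball y d) => //; split; exact: nbhsx_ballx.
    by exists (2 * m); split=> [|M /ltW //]; exact: num_real.
  move=> [[x' y'] M] [/= [xx yy] mM] f.
  apply: le_trans (_ : 2 * m * rnorm ((lam + (x' +i* y')) *: f - T f) <= _); last first.
    by rewrite ler_wpM2r ?rnorm_ge0.
  apply: lower_bound_near (lam + (x +i* y)) _ _ _ m0 _ _; last first.
    by rewrite -{1}(Sl f); exact: hm.
  rewrite (_ : _ - _ = (x - x') +i* (y - y')); last first.
    by rewrite opprD addrACA subrr add0r; simpc.
  apply: le_trans (rnorm_complex_le _ _) _.
  move: xx yy; rewrite /ball /= => xx yy.
  by rewrite [leRHS]splitr; apply: lerD; apply: ltW.
exists (Num.max (M + 1) 1); first by rewrite lt_max ltr01 orbT.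
move=> u f us.
have [h1 h2] := rnorm_ge_parts u.
have := hM (M + 1) _ (complex.Re u, complex.Im u) _ f.
rewrite ltrDl ltr01 => /(_ isT); rewrite /= !in_itv /= -!ler_norml.
move=> /(_ (conj (le_trans h1 us) (le_trans h2 us))).
have -> : complex.Re u +i* complex.Im u = u by case: (u).
move=> /le_trans; apply; rewrite ler_wpM2r ?rnorm_ge0 // le_max lexx //.
Qed.

(** With [b], [q], [d] the successive resolvent vectors that the resolvent identity
    produces from [u] to [v = u + w], this is the second-order remainder of
    [u *: phi u]. *)
Lemma vector_taylor (b q d : X) u w :
  u *: (b + w *: (q + w *: d)) - (u + w) *: b + w *: (b - (u + w) *: q) =
  w ^+ 2 *: (u *: d - q).
Proof.
rewrite !scalerDl !scalerDr !scalerN !scalerDr !scalerA expr2 mulrA [w * w * u]mulrC.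
rewrite mulrA [w * u]mulrC.
move: (u *: b) (w *: b) ((u * w) *: q) ((u * w * w) *: d) ((w * w) *: q) => ub wb uq d' q'.
rewrite opprD !opprD !addrA.
rewrite [ub + uq + d' - ub]addrAC [ub + uq - ub]addrAC subrr add0r subrK.
by rewrite [uq + d' - uq]addrAC subrr add0r.
Qed.

(** The mean value property for [F u = u *: phi u], where [phi u] is the resolvent at
    [lam + u] applied to [g]; the value [F 0] is zero whatever [phi 0] is. *)
Lemma resolvent_mean_value T lam (s e : R) g : 0 < s -> 0 < e ->
  (forall u, rnorm u <= 2 * s -> exists S, is_resolvent T (lam + u) S) ->
  exists phi : R[i] -> X,
  [/\ forall u, rnorm u <= s -> (lam + u) *: phi u - T (phi u) = g &
   exists N (om : R[i]), [/\ (0 < N)%N, rnorm om = 1 &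
   rnorm (\sum_(j < N) (s%:C * om ^+ j) *: phi (s%:C * om ^+ j)) <= N%:R * e]].
Proof.
move=> s0 e0 hS; have [M M0 hM] := resolvent_bound_on_disk s0 hS.
have /choice[S S_res] : forall u, exists S, rnorm u <= s ->
    is_resolvent T (lam + u) S /\ forall f, rnorm (S f) <= M * rnorm f.
  move=> u; have [us|us] := boolP (rnorm u <= s); last by exists (idfun : {linear X -> X}).
  have [|S hSu] := hS u; first by apply: le_trans us _; lra.
  exists S => _; split=> // f; have := hM u (S f) us.
  by case: hSu => _ _ ->.
exists (fun u => S u g); split; first by move=> u /S_res[[_ _ ->]].
pose F u := u *: S u g.
pose F' v := S v g - v *: S v (S v g).
pose K := (s * M + 1) * M ^+ 2 * rnorm g.
have K0 : 0 <= K.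
  by rewrite !mulr_ge0 ?rnorm_ge0 ?exprn_ge0 ?(ltW M0) // addr_ge0 // mulr_ge0 // ltW.
have taylor u v : rnorm u <= s -> rnorm v <= s ->
    rnorm (F u - F v - (u - v) *: F' v) <= K * rnorm (u - v) ^+ 2.
  move=> us vs; have [Ru Bu] := S_res u us; have [Rv Bv] := S_res v vs.
  have e1 := resolvent_identity g Ru Rv.
  have e2 := resolvent_identity (S v g) Ru Rv.
  have wE : lam + v - (lam + u) = v - u by rewrite opprD addrACA subrr add0r.
  rewrite wE in e1 e2; set b := S v g in e1 e2 *; set q := S v b in e2 *.
  set d := S u q in e2 *; set w := v - u in e1 e2.
  have -> : F u - F v - (u - v) *: F' v = w ^+ 2 *: (u *: d - q).
    rewrite -(vector_taylor b) -e2 -e1 /F /F' -/b -/q (_ : u + w = v); last by rewrite addrC subrK.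
    by rewrite -[u - v]opprB scaleNr opprK.
  rewrite rnormZ rnormX (rnormBC u v) mulrC ler_wpM2r ?exprn_ge0 ?rnorm_ge0 //.
  have qM : rnorm q <= M ^+ 2 * rnorm g.
    by apply: le_trans (Bv _) _; rewrite expr2 -mulrA ler_wpM2l ?(ltW M0) // Bv.
  apply: le_trans (ler_rnormB _ _) _; rewrite rnormZ.
  have h1 : rnorm u * rnorm d <= s * (M * (M ^+ 2 * rnorm g)).
    apply: ler_pM; rewrite ?rnorm_ge0 //; apply: le_trans (Bu _) _.
    by rewrite ler_wpM2l // ltW.
  by apply: le_trans (lerD h1 qM) _; rewrite /K; lra.
have [N [om [N0 omn h]]] := mean_value s0 K0 taylor e0.
exists N, om; split=> //.
by move: h; rewrite /F scale0r mul0rn subr0.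
Qed.
End ResolventOnDisk.

(** * Localization and persistence of the spectrum *)

Section Stability.
Variables (R : realType) (X : completeNormedModType R[i]) (w : X -> R).
Hypotheses (w_norm : is_norm w) (w_le : forall f, w f <= rnorm f).
Variables (C1 C2 C3 a A r : R).
Hypotheses (C1_gt0 : 0 < C1) (C2_gt0 : 0 < C2) (C3_gt0 : 0 < C3) (a_gt0 : 0 < a) (ar : a < r).
Implicit Types (S T : {linear X -> X}) (f g : X) (z lam : R[i]) (t : R).

Local Notation LY := (lasota_yorke w C1 C2 C3 a A).
Local Notation eta := (ln (r / a) / ln (A / a)).

(** The weak norm of the iterates [T^n g = lam^n g] grows no faster than [A^n]. *)
Lemma eigenvalue_le T lam g : 0 < A -> LY T -> g != 0 -> T g = lam *: g -> rnorm lam <= A.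
Proof.
move=> A0 hT g0 Tg; rewrite leNgt; apply/negP => Al.
have [w0 w_eq0 _ wZ] := w_norm.
have wg : 0 < w g.
  by rewrite lt_neqAle w0 andbT eq_sym; apply: contra_neq g0; exact: w_eq0.
have l0 : 0 < rnorm lam := lt_trans A0 Al.
have [||n hn] := @expr_small _ (A / rnorm lam) (2 * C1)^-1.
- by rewrite divr_ge0 ?(ltW A0) ?(ltW l0) //= ltr_pdivrMr // mul1r.
- by rewrite invr_gt0 mulr_gt0.
have := (hT g n).1; rewrite (iter_eigen n Tg) wZ rnormX ler_pM2r // => h.
have ln0 : 0 < rnorm lam ^+ n by rewrite exprn_gt0.
have : 1 <= C1 * (A / rnorm lam) ^+ n.
  by rewrite exprMn exprVn mulrA ler_pdivlMr // mul1r.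
apply/negP; rewrite -ltNge; apply: le_lt_trans (ler_wpM2l (ltW C1_gt0) hn) _.
rewrite invfM mulrCA mulfV ?gt_eqF // mulr1; lra.
Qed.

(** If the disk of radius [2 s] is free of spectrum of [T1], let
    [phi u = (lam + u - T1)^-1 g] and let [S] be the resolvent of [T0] at [lam + u].
    On the circle of radius [s] one has [S g = u^-1 g], hence
    [u phi u - g = u S ((T1 - T0) (phi u))], which is small in the weak norm.
    Averaging over the points of [resolvent_mean_value], whose mean is small, makes
    [w g] smaller than itself. *)
Lemma spectrum_persists T0 lam g p (d0 C : R) (s : R) :
  r < A -> LY T0 -> 0 < C -> g != 0 -> T0 g = lam *: g -> r + 2 * s <= rnorm lam ->
  0 < s <= d0 ->
  (forall z, 0 < rnorm (z - lam) <= d0 -> exists S, is_resolvent T0 z S /\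
      forall f, rnorm (S f) <= C / rnorm (z - lam) ^+ p * rnorm f) ->
  exists2 x : R, 0 < x & forall T1 t, LY T1 -> 0 < t <= 1 -> t `^ eta <= x ->
    (forall f, w (T1 f - T0 f) <= t * rnorm f) ->
    exists2 z, rnorm (z - lam) <= 2 * s & spectrum T1 z.
Proof.
move=> rA h0 Cp g0 Tg rs /andP[s0 sd] hres.
have [c [D [c0 D0 hlow]]] := perturbed_lower_bound w_norm w_le C1_gt0 C2_gt0 C3_gt0 a_gt0 ar rA.
have [w0 w_eq0 wD wZ] := w_norm.
have wN f : w (- f) = w f by rewrite -scaleN1r wZ rnormN /rnorm normr1 mul1r.
have wg : 0 < w g.
  by rewrite lt_neqAle w0 andbT eq_sym; apply: contra_neq g0; exact: w_eq0.
pose H := Num.max 1 (C / s ^+ p).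
have H1 : 1 <= H by rewrite le_max lexx.
have H0 : 0 < H by lra.
pose W := weak_const C1 C2 C3 a A r.
have W0 : 0 < W := weak_const_gt0 C1_gt0 C2_gt0 C3_gt0 a_gt0 ar rA.
(* B t^eta bounds the weak distance from u phi u to g on the circle. *)
pose B := s * (W * H * (D * H * rnorm g)) + 1.
have B0 : 0 < B.
  apply: ltr_wpDl => //.
  apply: mulr_ge0 (ltW s0) (mulr_ge0 (mulr_ge0 (ltW W0) (ltW H0)) _).
  exact: mulr_ge0 (mulr_ge0 (ltW D0) (ltW H0)) (rnorm_ge0 _).
exists (Num.min (c / H) (w g / (4 * B))).
  by rewrite lt_min !divr_gt0 // mulr_gt0.
move=> T1 t h1 t01; rewrite le_min => /andP[tc tB] hw.
apply: contrapT => nsp.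
have hS u : rnorm u <= 2 * s -> exists S, is_resolvent T1 (lam + u) S.
  move=> us; apply: contrapT => nS; apply: nsp; exists (lam + u) => //.
  by rewrite addrC addKr.
have w4 : 0 < w g / 4 by rewrite divr_gt0.
have [phi [hphi [N [om [N0 omn]]]]] := resolvent_mean_value g s0 w4 hS.
set u := fun j : nat => s%:C * om ^+ j.
have us j : rnorm (u j) = s.
  by rewrite /u rnormM rnormX omn expr1n mulr1 rnorm_real gtr0_norm.
have close j : w (u j *: phi (u j) - g) <= w g / 4.
  have uj0 : u j != 0 by apply/eqP => uE; have := us j; rewrite uE rnorm0; lra.
  set z := lam + u j.
  have zl : z - lam = u j by rewrite /z addrAC subrr add0r.
  have [|S [hRS SH]] := hres z; first by rewrite zl us s0.
  have {}SH f : rnorm (S f) <= H * rnorm f.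
    apply: le_trans (SH f) _; rewrite ler_wpM2r ?rnorm_ge0 // zl us.
    by rewrite le_max lexx orbT.
  have rz : r <= rnorm z.
    have : rnorm lam <= rnorm z + rnorm (u j).
      by rewrite (_ : lam = z - u j) ?ler_rnormB // /z addrK.
    by rewrite us; lra.
  have hz := hphi (u j) _; rewrite us lexx in hz; have {}hz := hz isT.
  have fb : rnorm (phi (u j)) <= D * H * rnorm g.
    rewrite -hz; apply: hlow h0 h1 rz H1 hRS SH t01 hw _.
    by rewrite mulrC -ler_pdivlMr.
  have Sg : S g = (u j)^-1 *: g.
    have [_ Sl _] := hRS; rewrite -[RHS]Sl; congr (S _).
    rewrite [T0 _]linearZ /= Tg !scalerA [z * _]mulrC -!scalerA -scalerBr.
    by rewrite -scalerBl zl scalerA mulVf ?scale1r.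
  have -> : u j *: phi (u j) - g = u j *: S (T1 (phi (u j)) - T0 (phi (u j))).
    have -> : T1 (phi (u j)) - T0 (phi (u j)) = (z *: phi (u j) - T0 (phi (u j))) - g.
      rewrite -hz; move: (z *: _) (T0 _) (T1 _) => x y v.
      by rewrite opprB [RHS]addrC subrKA.
    have [_ Sl _] := hRS; rewrite linearB Sl Sg scalerBr scalerA mulfV // scale1r //.
  rewrite wZ us.
  have := resolvent_difference_weak w_norm w_le C1_gt0 C2_gt0 C3_gt0 a_gt0 ar rA
    (phi (u j)) h0 h1 rz H1 hRS SH t01 hw.
  rewrite -/W => hd.
  have WH : 0 <= W * H * t `^ eta := mulr_ge0 (mulr_ge0 (ltW W0) (ltW H0)) (powR_ge0 _ _).
  have := ler_wpM2l (ltW s0) (le_trans hd (ler_wpM2l WH fb)).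
  move=> /le_trans; apply.
  have := ler_wpM2l (ltW B0) tB.
  have -> : B * (w g / (4 * B)) = w g / 4 by field; rewrite gt_eqF.
  have tp : 0 <= t `^ eta by exact: powR_ge0.
  rewrite /B mulrDl mul1r; move: (t `^ eta) tp => y; lra.
rewrite -/u => hsum.
have : w (g *+ N) <= N%:R * (w g / 4) + N%:R * (w g / 4).
  have -> : g *+ N = - \sum_(j < N) (u j *: phi (u j) - g) + \sum_(j < N) u j *: phi (u j).
    by rewrite sumrB sumr_const card_ord opprB subrK.
  apply: le_trans (wD _ _) _; apply: lerD; last exact: le_trans (w_le _) hsum.
  rewrite wN.
  have : forall n, w (\sum_(j < n) (u j *: phi (u j) - g)) <= n%:R * (w g / 4).
    elim=> [|n IH]; first by rewrite big_ord0 mul0r -(scale0r (0 : X)) wZ rnorm0 mul0r.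
    rewrite big_ord_recr /= -natr1 mulrDl mul1r; apply: le_trans (wD _ _) _.
    exact: lerD.
  exact.
have -> : w (g *+ N) = N%:R * w g.
  rewrite -scaler_nat wZ; congr (_ * _).
  have <- : (N%:R)%:C = N%:R :> R[i] by rewrite rmorph_nat.
  by rewrite rnorm_real ger0_norm.
rewrite -mulrDr ler_pM2l ?ltr0n //; lra.
Qed.

(** With [H] of order [|z - lam|^-p], the condition [H t^eta <= c] of
    [perturbed_lower_bound] reads [|z - lam| >= K t^(eta/p)]; beyond that distance
    [T1] has at most residual spectrum. *)
Lemma spectrum_localized T0 lam p (d0 C : R) :
  r < A -> LY T0 -> 0 < C -> 0 < d0 -> r + d0 <= rnorm lam -> (0 < p)%N ->
  (forall z, 0 < rnorm (z - lam) <= d0 -> exists S, is_resolvent T0 z S /\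
      forall f, rnorm (S f) <= C / rnorm (z - lam) ^+ p * rnorm f) ->
  exists2 K : R, 0 < K & forall T1 t z, LY T1 -> bounded_op T1 -> 0 < t <= 1 ->
    (forall f, w (T1 f - T0 f) <= t * rnorm f) ->
    rnorm (z - lam) <= d0 -> spectrum T1 z -> ~ residual_spectrum T1 z ->
    rnorm (z - lam) <= K * t `^ (eta / p%:R).
Proof.
move=> rA h0 C0 d00 rd p0 hres.
have [c [D [c0 D0 hlow]]] := perturbed_lower_bound w_norm w_le C1_gt0 C2_gt0 C3_gt0 a_gt0 ar rA.
(* Enlarging C makes the resolvent bound H at least 1 on the whole disk. *)
pose C' := C + d0 ^+ p.
have dp0 : 0 < d0 ^+ p by rewrite exprn_gt0.
have C'0 : 0 < C' by rewrite addr_gt0.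
have pn0 : p%:R != 0 :> R by rewrite pnatr_eq0 -lt0n.
exists ((C' / c) `^ p%:R^-1); first by rewrite powR_gt0 // divr_gt0.
move=> T1 t z h1 Tb t01 hw zd sp nres.
have [z0|z0] := eqVneq (z - lam) 0; first by rewrite z0 rnorm0 mulr_ge0 // powR_ge0.
have {}z0 := rnorm_gt0 z0; set d := rnorm (z - lam) in zd z0 *.
rewrite leNgt; apply/negP => hd; move: sp.
have [|S [hRS SH]] := hres z; first by rewrite -/d z0.
pose H := C' / d ^+ p.
have dn0 : 0 < d ^+ p by rewrite exprn_gt0.
have H1 : 1 <= H.
  rewrite /H ler_pdivlMr // mul1r /C'.
  have : d ^+ p <= d0 ^+ p by rewrite lerXn2r // nnegrE ltW.
  lra.
have {}SH f : rnorm (S f) <= H * rnorm f.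
  apply: le_trans (SH f) _; rewrite ler_wpM2r ?rnorm_ge0 // ler_wpM2r ?invr_ge0 ?(ltW dn0) //.
  by rewrite lerDl ltW.
have rz : r <= rnorm z.
  have : rnorm lam <= rnorm z + rnorm (z - lam).
    by have := ler_rnormB z (z - lam); rewrite subKr.
  by rewrite -/d; lra.
apply: (nonresidual_lower_bound (M := D * H) Tb _ nres) => f.
apply: hlow h0 h1 rz H1 hRS SH t01 hw _.
rewrite /H mulrAC ler_pdivrMr // [c * _]mulrC -ler_pdivrMr // mulrAC.
have <- : ((C' / c) `^ p%:R^-1 * t `^ (eta / p%:R)) ^+ p = C' / c * t `^ eta.
  rewrite exprMn -!powR_mulrn ?powR_ge0 // -!powRrM mulVf // divfK // powRr1 //.
  by rewrite divr_ge0 // ltW.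
by rewrite lerXn2r ?nnegrE ?mulr_ge0 ?powR_ge0 ?(ltW z0) // ltW.
Qed.
End Stability.

(** * The stability theorem *)

Lemma mixed_onorm_le (R : realType) (X : completeNormedModType R[i]) (w : X -> R)
    (T0 T1 : {linear X -> X}) f : is_norm w -> (forall f, w f <= rnorm f) ->
  bounded_op T0 -> bounded_op T1 ->
  w (T1 f - T0 f) <= onorm w (fun f => T1 f - T0 f) * rnorm f.
Proof.
move=> wn wle [M0 h0] [M1 h1].
apply: (le_onorm (T := fun f => T1 f - T0 f) (M := M1 + M0)) => // [c {}f|{}f].
  by rewrite [T1 _]linearZ [T0 _]linearZ /= scalerBr.
apply: le_trans (wle _) _; apply: le_trans (ler_rnormB _ _) _.
by rewrite mulrDl; apply: lerD.
Qed.

Theorem corollary3p4 (R : realType) (X : completeNormedModType R[i])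
    (w : X -> R) (hw : is_norm w) (hwle : forall f : X, w f <= rnorm f)
    (e' : R) (he' : 0 < e')
    (L : R -> {linear X -> X})
    (hL : forall e : R, 0 <= e <= e' -> bounded_op (L e))
    (C1 C2 C3 a A : R) (tau : R -> R)
    (h1 : KL1 w e' L C1 C2 C3 a A) (h2 : KL2 e' L a) (h3 : KL3 w e' L tau)
    (lam : R[i]) (p : nat) (hlam : a < rnorm lam)
    (hpole : resolvent_pole (L 0) lam p)
    (r : R) (hr : a < r < rnorm lam) :
  let eta := ln (r / a) / ln (A / a) in
  exists delta2 : R, 0 < delta2 /\
    forall delta : R, 0 < delta <= delta2 ->
    exists K2 : R, exists e2 : R,
      [/\ 0 < K2, 0 < e2 <= e',
          forall e : R, 0 <= e <= e2 ->
            disk delta lam `&` sigma_r r (L e) !=set0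
        & forall e : R, 0 <= e <= e2 ->
            sup [set rnorm (z - lam) | z in disk delta lam `&` sigma_r r (L e)]
            <= K2 * tau e `^ (eta / p%:R)].
Proof.
move=> eta; case: h1 => -[C10 C20 C30] /andP[a0 aA] hLY.
move: hr => /andP[ar rl].
have [tau0 _ _ tau_lim tau_on] := h3.
have E0 : 0 <= (0 : R) <= e' by rewrite lexx ltW.
have LY e : 0 <= e <= e' -> lasota_yorke w C1 C2 C3 a A (L e).
  by move=> he f n; exact: hLY.
have [p0 lam_sp _] := hpole.
have [d1 [C [g [d10 C0 g0 Lg hres1]]]] := pole_estimates (hL 0 E0) hpole.
have rA : r < A.
  have A0 := lt_trans a0 aA.
  exact: lt_le_trans rl (eigenvalue_le hw C10 A0 (LY 0 E0) g0 Lg).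
have eta0 : 0 < eta.
  have r0 := lt_trans a0 ar.
  by rewrite divr_gt0 // ln_gt0 // ltr_pdivlMr // mul1r.
pose d0 := Num.min d1 ((rnorm lam - r) / 2).
have d00 : 0 < d0 by rewrite lt_min d10 divr_gt0 // subr_gt0.
have d01 : d0 <= d1 by rewrite ge_min lexx.
have d0r : d0 <= (rnorm lam - r) / 2 by rewrite ge_min lexx orbT.
have rd : r + d0 <= rnorm lam by lra.
have hres z : 0 < rnorm (z - lam) <= d0 -> exists S : {linear X -> X}, is_resolvent (L 0) z S /\
    forall f, rnorm (S f) <= C / rnorm (z - lam) ^+ p * rnorm f.
  by move=> /andP[z0 zd]; apply: hres1; rewrite z0 (le_trans zd).
have [K K0 hK] := spectrum_localized hw hwle C10 C20 C30 a0 ar rA (LY 0 E0) C0 d00 rd p0 hres.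
exists d0; split=> // delta /andP[de0 ded].
have sd : 0 < delta / 2 <= d0 by rewrite divr_gt0 //=; lra.
have rs : r + 2 * (delta / 2) <= rnorm lam by lra.
have [x x0 hx] := spectrum_persists hw hwle C10 C20 C30 a0 ar rA (LY 0 E0) C0 g0 Lg rs sd hres.
have s2 : 2 * (delta / 2) = delta by lra.
rewrite s2 in hx.
(* t <= t0 means t <= 1 and t^eta <= x. *)
pose t0 := Num.min 1 (x `^ eta^-1).
have t00 : 0 < t0 by rewrite lt_min ltr01 powR_gt0.
have [e2 [/andP[e20 e2e] he2]] : exists e2, 0 < e2 <= e' /\
    forall e, 0 < e <= e2 -> tau e <= t0.
  have /cvgrPdist_lt/(_ _ t00)/nbhs_ballP[b /= b0 hb] := tau_lim.
  exists (Num.min e' (b / 2)); rewrite lt_min he' divr_gt0 // ge_min lexx; split=> // e.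
  rewrite le_min => /and3P[e0 ee eb]; have := hb e.
  rewrite /ball /= !sub0r !normrN gtr0_norm // e0.
  have -> : e < b by lra.
  by move=> /(_ isT isT) h; exact: le_trans (ler_norm _) (ltW h).
have diff e f : 0 <= e <= e' -> w (L e f - L 0 f) <= tau e * rnorm f.
  move=> he; apply: le_trans (mixed_onorm_le f hw hwle (hL 0 E0) (hL e he)) _.
  by rewrite ler_wpM2r ?rnorm_ge0 // tau_on.
have sigma_sp e z : disk delta lam z -> sigma_r r (L e) z -> spectrum (L e) z.
  rewrite /disk /sigma_r /= => zd [zr|//]; exfalso.
  have := ler_rnormB z (z - lam); rewrite subKr; lra.
have le_e' e : 0 <= e <= e2 -> 0 <= e <= e'.
  by move=> /andP[-> ee]; rewrite (le_trans ee e2e).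
(* The estimates need a positive size of the perturbation.  When e = 0, where tau
   may be large, or tau e = 0, the two operators coincide and the spectrum in the
   disk is reduced to lam. *)
have dich e : 0 <= e <= e2 -> L e =1 L 0 \/ 0 < tau e <= t0.
  move=> he; move: (he) => /andP[]; rewrite le_eqVlt => /predU1P[<- _|e0 ee]; first by left.
  have := tau0 e (le_e' e he); rewrite le_eqVlt => /predU1P[te|te]; last first.
    by right; rewrite te he2 // e0.
  left=> f; apply/subr0_eq; have [w0 w_eq0 _ _] := hw; apply: w_eq0.
  apply/eqP; rewrite eq_le w0 andbT; have := diff e f (le_e' e he).
  by rewrite -te mul0r.
have same e z : L e =1 L 0 -> spectrum (L e) z <-> spectrum (L 0) z.
  move=> E; split=> nS [S [Sb Sl Sr]]; apply: nS; exists S; split=> // f;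
    by rewrite ?E // -?E.
have t01 e : 0 < tau e <= t0 -> 0 < tau e <= 1.
  by move=> /andP[-> /le_trans]; apply; rewrite ge_min lexx.
have loc e : 0 <= e <= e2 -> exists2 z, disk delta lam z & spectrum (L e) z.
  move=> he; have [E|te] := dich e he.
    by exists lam; [rewrite /disk /= subrr rnorm0 ltW|apply/same].
  apply: hx (LY e (le_e' e he)) (t01 e te) _ _; last by move=> f; exact/diff/le_e'.
  have {te}/andP[te tt] := te.
  have : tau e `^ eta <= (x `^ eta^-1) `^ eta.
    apply: ge0_ler_powR; rewrite ?nnegrE ?powR_ge0 ?(ltW eta0) ?(ltW te) //.
    by apply: le_trans tt _; rewrite ge_min lexx orbT.
  by rewrite -powRrM mulVf ?gt_eqF // powRr1 // ltW.
have bnd e z : 0 <= e <= e2 -> disk delta lam z -> spectrum (L e) z ->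
    rnorm (z - lam) <= K * tau e `^ (eta / p%:R).
  move=> he zd zs; have heE := le_e' e he; have zd0 : rnorm (z - lam) <= d0 := le_trans zd ded.
  have zr : a < rnorm z by have := ler_rnormB z (z - lam); rewrite subKr; lra.
  have [E|te] := dich e he; last first.
    by apply: hK (LY e heE) (hL e heE) (t01 e te) _ zd0 zs (h2 e heE z zs zr) => f; exact: diff.
  have [z0|z0] := eqVneq (z - lam) 0.
    by rewrite z0 rnorm0 mulr_ge0 ?powR_ge0 // ltW.
  exfalso; move/same: zs => /(_ E); apply.
  have [|S [hS _]] := hres z; last by exists S.
  by rewrite rnorm_gt0.
exists K, e2; split=> //; first by rewrite e20.
  by move=> e /loc[z zd zs]; exists z; split=> //; right.
move=> e he; apply: ge_sup.
  by have [z zd zs] := loc e he; exists (rnorm (z - lam)), z => //; split=> //; right.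
by move=> _ [z [zd zs] <-]; apply: bnd => //; exact: sigma_sp zs.
Qed.
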